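(* Let $T>0$, $f_0,f_T$ smooth, $K_1,K_2\ge1$ integers, and let $A$, $c_1$, $c_2$ and $a_1,\dots,a_K$ be as defined in the context. There exists exactly one minimum-input solution for the $L^1$ metric if and only if there is $j\in\{1,\dots,K\}$ such that $\int_{-T}^T a_j(x)\,dx=A$, $a_j\in C^1[-T,T]$, $a_j(T)=a_j(-T)+c_1$ and $a_j'(T)=a_j'(-T)+c_2$. Otherwise, if a minimum-input solution exists, there are infinitely many of them.
   Context: TBVP: given smooth $f_0,f_T:\mathbb R\to\mathbb R$ and $T>0$, a solution is a function $u\in C^2([0,T]\times\mathbb R)$ with $u_{tt}-u_{xx}=0$, $u(0,x)=f_0(x)$, $u(T,x)=f_T(x)$. Its input is $v(x)=u_t(0,x)$; the set of all inputs is the input space. Metric: fix integers $K_1,K_2\ge 1$, put $K=K_1+K_2+1$; inputs are measured by the norm of $L^1[-(2K_1+1)T,(2K_2+1)T]$. A minimum-input solution (MS) is a solution whose input has minimal norm among all inputs. Constants: $A=2f_T(0)-f_0(T)-f_0(-T)$, $c_1=2f_T'(0)-f_0'(T)-f_0'(-T)$, $c_2=2f_T''(0)-f_0''(T)-f_0''(-T)$. Functions $t_i$ on $[-T,T]$, $i=1,\dots,K$: $t_1=0$; for $k=1,\dots,K_2$, $$t_{k+1}(x)=f_0'(x)+2\sum_{n=0}^{k-1}f_0'(x+(2k-2n)T)-2\sum_{n=0}^{k-1}f_T'(x+(2k-2n-1)T)-f_0'(x+2kT);$$ for $k=1,\dots,K_1$, $$t_{k+K_2+1}(x)=f_0'(x)+2\sum_{n=0}^{k-1}f_T'(x+(2n+1-2k)T)-2\sum_{n=0}^{k-1}f_0'(x+2(n+1-k)T)-f_0'(x-2kT).$$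 For $x\in[-T,T]$ let $a_1(x)\ge a_2(x)\ge\dots\ge a_K(x)$ be the values $t_1(x),\dots,t_K(x)$ arranged in decreasing order (with multiplicity). *)

(* Defs.v *)
From Stdlib Require Import Reals Lra List Mergesort Orders.
From Coquelicot Require Import Coquelicot.

Open Scope R_scope.

Definition smooth (f : R -> R) : Prop := forall n x, ex_derive_n f n x.

(* Derivative relative to a set D: this is [is_derive] with [locally x]
   restricted to D, hence a one-sided derivative at an endpoint of an
   interval D. *)
Definition is_derive_within (D : R -> Prop) (f : R -> R) (x l : R) : Prop :=
  filterdiff f (within D (locally x)) (fun y => scal y l).

Definition C1_on_with (a b : R) (f f' : R -> R) : Prop :=
  (forall x, a <= x <= b ->
     is_derive_within (fun y => a <= y <= b) f x (f' x)) /\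
  continuous_on (fun y => a <= y <= b) f'.

(* Functions on [0,T] x R are represented by total functions on R * R whose
   values off the strip are irrelevant. *)
Definition strip (T : R) (p : R * R) : Prop := 0 <= fst p <= T.

Definition eq_on_strip (T : R) (g h : R * R -> R) : Prop :=
  forall p, strip T p -> g p = h p.

Definition partial_t (T : R) (g gt : R * R -> R) : Prop :=
  forall t x, strip T (t, x) ->
    is_derive_within (fun s => 0 <= s <= T) (fun s => g (s, x)) t (gt (t, x)).

Definition partial_x (T : R) (g gx : R * R -> R) : Prop :=
  forall t x, strip T (t, x) ->
    is_derive (fun y => g (t, y)) x (gx (t, x)).

Definition C1_strip (T : R) (g : R * R -> R) : Prop :=
  continuous_on (strip T) g /\
  exists gt gx, partial_t T g gt /\ partial_x T g gx /\
    continuous_on (strip T) gt /\ continuous_on (strip T) gx.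

Definition C2_strip (T : R) (g : R * R -> R) : Prop :=
  continuous_on (strip T) g /\
  exists gt gx, partial_t T g gt /\ partial_x T g gx /\
    C1_strip T gt /\ C1_strip T gx.

Definition wave_equation (T : R) (u : R * R -> R) : Prop :=
  exists ut utt ux uxx,
    partial_t T u ut /\ partial_t T ut utt /\
    partial_x T u ux /\ partial_x T ux uxx /\
    forall p, strip T p -> utt p - uxx p = 0.

Definition is_solution (f0 fT : R -> R) (T : R) (u : R * R -> R) : Prop :=
  C2_strip T u /\ wave_equation T u /\
  (forall x, u (0, x) = f0 x) /\ (forall x, u (T, x) = fT x).

(* v = u_t(0, .), a one-sided derivative since u lives on [0,T] x R *)
Definition has_input (T : R) (u : R * R -> R) (v : R -> R) : Prop :=
  forall x, is_derive_within (fun s => 0 <= s <= T) (fun s => u (s, x)) 0 (v x).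

Definition input_space (f0 fT : R -> R) (T : R) (v : R -> R) : Prop :=
  exists u, is_solution f0 fT T u /\ has_input T u v.

(* Norm of L^1[-(2 K1 + 1) T, (2 K2 + 1) T]. It is only applied to inputs,
   which are continuous, so the Riemann integral is the Lebesgue integral. *)
Definition L1_norm (T : R) (K1 K2 : nat) (v : R -> R) : R :=
  RInt (fun x => Rabs (v x)) (- (2 * INR K1 + 1) * T) ((2 * INR K2 + 1) * T).

Definition is_MS (f0 fT : R -> R) (T : R) (K1 K2 : nat) (u : R * R -> R) : Prop :=
  is_solution f0 fT T u /\
  exists v, has_input T u v /\
    forall w, input_space f0 fT T w -> L1_norm T K1 K2 v <= L1_norm T K1 K2 w.

Definition exactly_one_MS (f0 fT : R -> R) (T : R) (K1 K2 : nat) : Prop :=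
  exists u, is_MS f0 fT T K1 K2 u /\
    forall u', is_MS f0 fT T K1 K2 u' -> eq_on_strip T u u'.

Definition infinitely_many_MS (f0 fT : R -> R) (T : R) (K1 K2 : nat) : Prop :=
  exists U : nat -> R * R -> R,
    (forall n, is_MS f0 fT T K1 K2 (U n)) /\
    forall m n, m <> n -> ~ eq_on_strip T (U m) (U n).

Definition const_A (f0 fT : R -> R) (T : R) : R :=
  2 * fT 0 - f0 T - f0 (- T).

Definition const_c1 (f0 fT : R -> R) (T : R) : R :=
  2 * Derive fT 0 - Derive f0 T - Derive f0 (- T).

Definition const_c2 (f0 fT : R -> R) (T : R) : R :=
  2 * Derive_n fT 2 0 - Derive_n f0 2 T - Derive_n f0 2 (- T).

(* t_{k+1} for 1 <= k <= K2; [sum_n F (k - 1)] is F 0 + ... + F (k - 1). *)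
Definition t_right (f0 fT : R -> R) (T : R) (k : nat) (x : R) : R :=
  Derive f0 x
  + 2 * sum_n (fun n => Derive f0 (x + (2 * INR k - 2 * INR n) * T)) (k - 1)
  - 2 * sum_n (fun n => Derive fT (x + (2 * INR k - 2 * INR n - 1) * T)) (k - 1)
  - Derive f0 (x + 2 * INR k * T).

(* t_{k+K2+1} for 1 <= k <= K1 *)
Definition t_left (f0 fT : R -> R) (T : R) (k : nat) (x : R) : R :=
  Derive f0 x
  + 2 * sum_n (fun n => Derive fT (x + (2 * INR n + 1 - 2 * INR k) * T)) (k - 1)
  - 2 * sum_n (fun n => Derive f0 (x + 2 * (INR n + 1 - INR k) * T)) (k - 1)
  - Derive f0 (x - 2 * INR k * T).

(* [t_1(x); ...; t_K(x)], with K = K1 + K2 + 1 *)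
Definition t_values (f0 fT : R -> R) (T : R) (K1 K2 : nat) (x : R) : list R :=
  0 :: map (fun k => t_right f0 fT T k x) (seq 1 K2)
    ++ map (fun k => t_left f0 fT T k x) (seq 1 K1).

Module RGeOrder <: TotalLeBool.
  Definition t := R.
  Definition leb (x y : R) : bool := if Rle_dec y x then true else false.
  Lemma leb_total : forall x y, leb x y = true \/ leb y x = true.
  Proof.
    intros x y; unfold leb.
    destruct (Rle_dec y x); [now left|].
    destruct (Rle_dec x y); [now right|lra].
  Qed.
End RGeOrder.

Module RDecreasing := Sort RGeOrder.

(* a_j(x), with j counted from 1 *)
Definition a_fun (f0 fT : R -> R) (T : R) (K1 K2 j : nat) (x : R) : R :=
  nth (j - 1) (RDecreasing.sort (t_values f0 fT T K1 K2 x)) 0.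

Definition a_condition (f0 fT : R -> R) (T : R) (K1 K2 : nat) : Prop :=
  exists j : nat, (1 <= j <= K1 + K2 + 1)%nat /\
    let a := a_fun f0 fT T K1 K2 j in
    RInt a (- T) T = const_A f0 fT T /\
    exists a', C1_on_with (- T) T a a' /\
      a T = a (- T) + const_c1 f0 fT T /\
      a' T = a' (- T) + const_c2 f0 fT T.

(* Main.v *)
Require Import Defs.
From Stdlib Require Import Reals ZArith Lra Lia List Permutation Sorted Classical.
From Coquelicot Require Import Coquelicot.
Open Scope R_scope.

(** By d'Alembert's formula a solution is determined by its input [v], and the
    inputs are the functions of class C1 on the line such that the integral of
    [v] over [x - T, x + T] is [2 fT(x) - f0(x + T) - f0(x - T)] for all [x]
    ([dAlembert_formula], [dAlembert_solution]). Equivalently, the integral of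
    [v] over [-T, T] is [A] and [v] satisfies a difference equation of step
    [2 T] ([admissible_iff]). A function of class C1 on [-T, T] with
    integral [A] therefore extends to an input exactly when it and its
    derivative jump by [c1] and [c2] across the period ([C1_extension]).

    The difference equation gives [v(x + s) = v(x) - t_i(x)] for the [K]
    translations [s] that carry [-T, T] onto the periods of the norm interval
    ([t_values_eq]). So the norm of [v] is the integral over [-T, T] of the
    sum over [i] of [|v(x) - t_i(x)|] ([L1_norm_shifts], [cost_t_values]), which
    for each [x] is a piecewise affine convex function of [v(x)] with
    breakpoints [a_1(x) >= ... >= a_K(x)].

    If some [a_j] extends to an input, it is the only minimizer: the slope
    [K + 1 - 2 j] lies inside the subdifferential at [a_j(x)] with a margin [1]
    on both sides, and, being independent of [x], it contributes nothing after
    integration since all inputs have the same mean ([cost_ranked],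
    [ranked_minimal]).

    Conversely let [v] be the only minimizer. If the slope to the left of
    [v(x1)] were at least the slope to the right of [v(x2)], for some [x1] and
    [x2] in the period, lowering [v] near [x1] and raising it equally near [x2]
    would not increase the norm ([free_perturbation]). These slopes are
    expressed by the numbers of [t_i] not smaller than [v], respectively
    greater than [v], so every number of the second kind is smaller than every
    number of the first kind ([unique_counts]). Hence one [j] separates the two
    kinds for all [x] at once, which means [v = a_j] on [-T, T]
    ([unique_a_condition]).

    Two distinct minimizers span a segment of minimizers, so without uniqueness
    there are none or infinitely many ([two_MS_infinitely_many]). *)

(** * Derivatives relative to an interval *)

(** The filter in the definition converges to [x] only, because [x] lies in
    [D]; so the derivative is the usual first-order expansion, tested on [D]. *)
Lemma is_derive_within_iff (D : R -> Prop) (f : R -> R) (x l : R) :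
  D x ->
  (is_derive_within D f x l <->
   forall eps : posreal,
     locally x (fun y => D y ->
       Rabs (f y - f x - (y - x) * l) <= eps * Rabs (y - x))).
Proof.
  intros Dx; split.
  - intros [_ Hd] eps.
    refine (Hd x _ eps).
    intros P HP; unfold within; revert HP; apply filter_imp; auto.
  - intros H; split.
    + apply (is_linear_scal_l l).
    + intros z Hz eps.
      (* the filter within D (locally x) converges to x only *)
      assert (Hzx : x = z).
      { apply NNPP; intros Hne.
        assert (Hp : 0 < Rabs (x - z)) by (apply Rabs_pos_lt; lra).
        assert (Hb : locally z (fun y => Rabs (y - z) < Rabs (x - z))).
        { exists (mkposreal _ Hp); intros y Hy; exact Hy. }
        specialize (Hz _ Hb).
        assert (Rabs (x - z) < Rabs (x - z)); [|lra].
        exact (locally_singleton _ _ Hz Dx). }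
      subst z; exact (H eps).
Qed.

Lemma is_derive_within_of_is_derive (D : R -> Prop) (f : R -> R) (x l : R) :
  D x -> is_derive f x l -> is_derive_within D f x l.
Proof.
  intros Dx [_ Hd]; apply is_derive_within_iff; [exact Dx|]; intros eps.
  assert (H : locally x (fun y => Rabs (f y - f x - (y - x) * l)
                                  <= eps * Rabs (y - x))).
  { refine (Hd x _ eps); intros P HP; exact HP. }
  revert H; apply filter_imp; auto.
Qed.

Lemma is_derive_of_within (D : R -> Prop) (f : R -> R) (x l : R) :
  locally x D -> is_derive_within D f x l -> is_derive f x l.
Proof.
  intros HD Hw.
  pose proof (proj1 (is_derive_within_iff D f x l (locally_singleton _ _ HD)) Hw)
    as H.
  split; [apply (is_linear_scal_l l)|].
  intros z Hz eps; rewrite <- (is_filter_lim_locally_unique _ _ Hz).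
  generalize (filter_and _ _ HD (H eps)); apply filter_imp.
  intros y [Dy Hy]; exact (Hy Dy).
Qed.

Lemma is_derive_within_ext (D : R -> Prop) (f g : R -> R) (x l : R) :
  D x -> (forall y, D y -> f y = g y) ->
  is_derive_within D f x l -> is_derive_within D g x l.
Proof.
  intros Dx He Hf; rewrite is_derive_within_iff in Hf by exact Dx.
  apply is_derive_within_iff; [exact Dx|]; intros eps.
  generalize (Hf eps); apply filter_imp; intros y Hy Dy.
  rewrite <- !He by assumption; now apply Hy.
Qed.

Lemma is_derive_within_continuous (D : R -> Prop) (f : R -> R) (x l : R) :
  D x -> is_derive_within D f x l ->
  filterlim f (within D (locally x)) (locally (f x)).
Proof.
  intros Dx Hf; rewrite is_derive_within_iff in Hf by exact Dx.
  apply filterlim_locally; intros eps.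
  pose proof (Rabs_pos l) as Hl.
  assert (Hp : 0 < eps / (1 + Rabs l)).
  { apply Rdiv_lt_0_compat; [apply cond_pos|lra]. }
  generalize (filter_and _ _ (Hf (mkposreal 1 Rlt_0_1))
                (locally_ball x (mkposreal _ Hp))).
  unfold within; apply filter_imp; intros y [H1 H2] Dy; specialize (H1 Dy).
  change (Rabs (y - x) < eps / (1 + Rabs l)) in H2; simpl in H1.
  change (Rabs (f y - f x) < eps).
  apply Rle_lt_trans with (Rabs (y - x) * (1 + Rabs l)).
  - replace (f y - f x) with ((f y - f x - (y - x) * l) + (y - x) * l) by ring.
    eapply Rle_trans; [apply Rabs_triang|].
    rewrite (Rabs_mult (y - x)); lra.
  - apply Rmult_lt_compat_r with (r := 1 + Rabs l) in H2; [|lra].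
    unfold Rdiv in H2; rewrite Rmult_assoc, Rinv_l in H2; lra.
Qed.

Lemma locally_interior (a b x : R) :
  a < x < b -> locally x (fun y => a <= y <= b).
Proof.
  intros Hx.
  assert (Hp : 0 < Rmin (x - a) (b - x)) by (apply Rmin_case; lra).
  exists (mkposreal _ Hp); intros y Hy.
  change (Rabs (y - x) < Rmin (x - a) (b - x)) in Hy.
  pose proof (Rmin_l (x - a) (b - x)); pose proof (Rmin_r (x - a) (b - x)).
  apply Rabs_def2 in Hy; lra.
Qed.

(** An input is a one-sided derivative at [t = 0], so it depends only on the
    values of the solution on the strip. *)
Lemma is_derive_within_unique_left (T : R) (f g : R -> R) (l l' : R) :
  0 < T ->
  (forall s, 0 <= s <= T -> f s = g s) ->
  is_derive_within (fun s => 0 <= s <= T) f 0 l ->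
  is_derive_within (fun s => 0 <= s <= T) g 0 l' -> l = l'.
Proof.
  intros hT Hfg Hf Hg.
  rewrite is_derive_within_iff in Hf by lra.
  rewrite is_derive_within_iff in Hg by lra.
  apply NNPP; intros Hne.
  assert (Hp : 0 < Rabs (l - l') / 4).
  { apply Rdiv_lt_0_compat; [apply Rabs_pos_lt|]; lra. }
  destruct (filter_and _ _ (Hf (mkposreal _ Hp)) (Hg (mkposreal _ Hp)))
    as [[d Hd] H].
  simpl in H.
  set (y := Rmin (d / 2) T).
  assert (Hy : 0 < y <= T /\ y < d).
  { unfold y; pose proof (Rmin_l (d / 2) T); pose proof (Rmin_r (d / 2) T).
    split; [split|]; [apply Rmin_case| |]; lra. }
  destruct (H y) as [H1 H2].
  { change (Rabs (y - 0) < d); rewrite Rabs_pos_eq; lra. }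
  assert (Dy : 0 <= y <= T) by lra.
  specialize (H1 Dy); specialize (H2 Dy).
  rewrite <- (Hfg y Dy), <- (Hfg 0) in H2 by lra.
  rewrite (Rabs_pos_eq (y - 0)) in H1, H2 by lra.
  assert (H3 : Rabs ((y - 0) * (l - l')) <= Rabs (l - l') / 2 * y).
  { replace ((y - 0) * (l - l')) with
      ((f y - f 0 - (y - 0) * l') - (f y - f 0 - (y - 0) * l)) by ring.
    eapply Rle_trans; [apply Rabs_triang|]; rewrite Rabs_Ropp; lra. }
  rewrite Rabs_mult, (Rabs_pos_eq (y - 0)) in H3 by lra.
  assert (0 < y * Rabs (l - l')) by (apply Rmult_lt_0_compat; lra).
  lra.
Qed.

(** * Continuity and integration of real functions *)

Lemma continuous_Rext (f g : R -> R) (x : R) :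
  (forall y, f y = g y) -> continuous f x -> continuous g x.
Proof. exact (continuous_ext f g x). Qed.

Lemma continuous_Rplus {U : UniformSpace} (f g : U -> R) (x : U) :
  continuous f x -> continuous g x -> continuous (fun y => f y + g y) x.
Proof. exact (continuous_plus f g x). Qed.

Lemma continuous_Rminus {U : UniformSpace} (f g : U -> R) (x : U) :
  continuous f x -> continuous g x -> continuous (fun y => f y - g y) x.
Proof. exact (continuous_minus f g x). Qed.

Lemma continuous_Rscal {U : UniformSpace} (k : R) (f : U -> R) (x : U) :
  continuous f x -> continuous (fun y => k * f y) x.
Proof. exact (continuous_scal_r k f x). Qed.

Lemma continuous_compose {U : UniformSpace} (f : U -> R) (g : R -> R) (x : U) :
  continuous f x -> continuous g (f x) -> continuous (fun y => g (f y)) x.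
Proof. exact (continuous_comp f g x). Qed.

Lemma continuous_shift_at (f : R -> R) (s x z : R) :
  continuous f x -> z + s = x -> continuous (fun y => f (y + s)) z.
Proof.
  intros H <-; apply (continuous_compose (fun y => y + s) f); [|exact H].
  apply continuous_Rplus; [apply continuous_id|apply continuous_const].
Qed.

Lemma continuous_shift (f : R -> R) (s x : R) :
  (forall y, continuous f y) -> continuous (fun y => f (y + s)) x.
Proof. intros H; exact (continuous_shift_at f s (x + s) x (H _) eq_refl). Qed.

Lemma is_derive_continuous (f : R -> R) (x l : R) :
  is_derive f x l -> continuous f x.
Proof.
  intros H.
  exact (ex_derive_continuous f x (ex_intro _ l H)).
Qed.

Lemma ex_RInt_cont (f : R -> R) (a b : R) :
  (forall x, continuous f x) -> ex_RInt f a b.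
Proof. intros H; apply @ex_RInt_continuous; auto. Qed.

Lemma continuous_Rmax0 (f : R -> R) (x : R) :
  continuous f x -> continuous (fun y => Rmax 0 (f y)) x.
Proof.
  intros H.
  apply continuous_ext with (fun y => / 2 * (f y + Rabs (f y))).
  { intros y; unfold Rmax, Rabs.
    destruct (Rle_dec 0 (f y)), (Rcase_abs (f y)); lra. }
  apply continuous_Rscal, continuous_Rplus; [exact H|].
  now apply continuous_Rabs_comp.
Qed.

Definition clamp (a b x : R) : R := Rmax a (Rmin b x).

Lemma clamp_in (a b x : R) : a <= b -> a <= clamp a b x <= b.
Proof.
  intros H; unfold clamp, Rmax, Rmin.
  destruct (Rle_dec b x), (Rle_dec a _); lra.
Qed.

Lemma clamp_id (a b x : R) : a <= x <= b -> clamp a b x = x.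
Proof.
  intros H; unfold clamp, Rmax, Rmin.
  destruct (Rle_dec b x), (Rle_dec a _); lra.
Qed.

Lemma clamp_dist (a b x y : R) :
  a <= b -> Rabs (clamp a b y - clamp a b x) <= Rabs (y - x).
Proof.
  intros H; unfold clamp, Rmax, Rmin, Rabs.
  destruct (Rle_dec b x), (Rle_dec b y);
  repeat (destruct (Rle_dec a _)); repeat (destruct (Rcase_abs _)); lra.
Qed.

Lemma continuous_clamp (g : R -> R) (a b x : R) :
  a <= b -> continuous_on (fun y => a <= y <= b) g ->
  continuous (fun y => g (clamp a b y)) x.
Proof.
  intros Hab Hg P HP.
  destruct (Hg _ (clamp_in a b x Hab) P HP) as [d Hd].
  exists d; intros y Hy; apply Hd; [|now apply clamp_in].
  eapply Rle_lt_trans; [apply clamp_dist, Hab|exact Hy].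
Qed.

(** Freezing time outside [0, T] turns continuity relative to the closed
    strip into continuity on the plane. *)
Lemma continuous_clamp_strip (T : R) (g : R * R -> R) (p : R * R) :
  0 <= T -> continuous_on (strip T) g ->
  continuous (fun q : R * R => g (clamp 0 T (fst q), snd q)) p.
Proof.
  intros hT Hg P HP.
  destruct (Hg (clamp 0 T (fst p), snd p) (clamp_in 0 T (fst p) hT) P HP)
    as [d Hd].
  exists d; intros q [Hq1 Hq2]; apply Hd; [|apply (clamp_in 0 T (fst q) hT)].
  split; [|exact Hq2].
  eapply Rle_lt_trans; [apply clamp_dist, hT|exact Hq1].
Qed.

Lemma continuous_clamp_comp (T : R) (g : R * R -> R) (h k : R -> R) (s : R) :
  0 <= T -> continuous_on (strip T) g -> continuous h s -> continuous k s ->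
  continuous (fun s => g (clamp 0 T (h s), k s)) s.
Proof.
  intros hT Hg Hh Hk.
  apply (continuous_comp_2 h k (fun a b => g (clamp 0 T a, b)) s Hh Hk).
  now apply (continuous_clamp_strip T g (h s, k s)).
Qed.

Lemma continuous_on_of_continuous {U V : UniformSpace} (D : U -> Prop)
  (f : U -> V) : (forall x, continuous f x) -> continuous_on D f.
Proof.
  intros H x _ P HP; generalize (H x P HP).
  unfold filtermap, within; apply filter_imp; auto.
Qed.

Lemma is_derive_value (f : R -> R) (x l l' : R) :
  is_derive f x l -> l = l' -> is_derive f x l'.
Proof. now intros H <-. Qed.

Lemma is_derive_Rplus (f g : R -> R) (x a b : R) :
  is_derive f x a -> is_derive g x b -> is_derive (fun x => f x + g x) x (a + b).
Proof. exact (is_derive_plus f g x a b). Qed.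

Lemma is_derive_Rminus (f g : R -> R) (x a b : R) :
  is_derive f x a -> is_derive g x b -> is_derive (fun x => f x - g x) x (a - b).
Proof. exact (is_derive_minus f g x a b). Qed.

Lemma is_derive_shift (F F' : R -> R) (c x : R) :
  (forall x, is_derive F x (F' x)) ->
  is_derive (fun x => F (x + c)) x (F' (x + c)).
Proof.
  intros H.
  apply is_derive_value with (1 * F' (x + c)); [|ring].
  apply (is_derive_comp F (fun x => x + c)); [apply H|].
  auto_derive; [exact I|ring].
Qed.

Lemma is_derive_affine (F F' : R -> R) (c k s : R) :
  (forall x, is_derive F x (F' x)) ->
  is_derive (fun s => F (c + k * s)) s (k * F' (c + k * s)).
Proof.
  intros H; apply (is_derive_comp F (fun s => c + k * s)); [apply H|].
  auto_derive; [exact I|ring].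
Qed.

Lemma is_derive_primitive (v : R -> R) (a x : R) :
  (forall y, continuous v y) -> is_derive (fun y => RInt v a y) x (v x).
Proof.
  intros Hc; apply (is_derive_RInt v _ a); [|apply Hc].
  apply filter_forall; intros y.
  exact (RInt_correct v a y (ex_RInt_cont v a y Hc)).
Qed.

Lemma RInt_primitive (v V : R -> R) (a b : R) :
  (forall y, continuous v y) -> (forall x, is_derive V x (v x)) ->
  RInt v a b = V b - V a.
Proof.
  intros Hc HV; apply is_RInt_unique.
  apply (is_RInt_derive V v); intros x _; [apply HV|apply Hc].
Qed.

Lemma RInt_Rplus (f g : R -> R) (a b : R) :
  (forall x, continuous f x) -> (forall x, continuous g x) ->
  RInt (fun x => f x + g x) a b = RInt f a b + RInt g a b.
Proof.
  intros Hf Hg; apply (RInt_plus f g a b); now apply ex_RInt_cont.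
Qed.

Lemma RInt_Rscal (f : R -> R) (k a b : R) :
  (forall x, continuous f x) ->
  RInt (fun x => k * f x) a b = k * RInt f a b.
Proof. intros Hf; apply (RInt_scal f a b k); now apply ex_RInt_cont. Qed.

Lemma RInt_shift (f : R -> R) (s a b : R) :
  (forall x, continuous f x) ->
  RInt (fun x => f (x + s)) a b = RInt f (a + s) (b + s).
Proof.
  intros Hf.
  pose proof (RInt_comp_lin f 1 s a b (ex_RInt_cont f _ _ Hf)) as H.
  rewrite !Rmult_1_l in H; rewrite <- H.
  apply RInt_ext; intros x _.
  change (f (x + s) = 1 * f (1 * x + s)); rewrite !Rmult_1_l; reflexivity.
Qed.

Lemma RInt_split (f : R -> R) (a b c : R) :
  (forall x, continuous f x) -> RInt f a c = RInt f a b + RInt f b c.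
Proof.
  intros Hf; symmetry; apply (RInt_Chasles f a b c); now apply ex_RInt_cont.
Qed.

Lemma RInt_nonneg_zero (g : R -> R) (a b : R) :
  a < b -> (forall x, continuous g x) -> (forall x, 0 <= g x) ->
  RInt g a b <= 0 -> forall x, a <= x <= b -> g x = 0.
Proof.
  intros Hab Hc Hg HI x0 Hx0.
  destruct (Req_dec (g x0) 0) as [|Hne]; [assumption|exfalso].
  assert (Hp : 0 < g x0) by (specialize (Hg x0); lra).
  destruct (proj1 (filterlim_locally _ _) (Hc x0) (mkposreal _ Hp)) as [d Hd].
  pose proof (cond_pos d).
  set (c := Rmax a (x0 - d / 2)); set (e := Rmin b (x0 + d / 2)).
  assert (Hce : a <= c /\ c < e /\ e <= b /\ x0 - d < c /\ e < x0 + d).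
  { unfold c, e, Rmax, Rmin.
    destruct (Rle_dec a _), (Rle_dec b _); repeat split; lra. }
  assert (0 < RInt g c e).
  { apply RInt_gt_0; [lra| |auto]; intros x Hx.
    assert (Hb : Rabs (g x - g x0) < g x0).
    { apply (Hd x); change (Rabs (x - x0) < d); apply Rabs_def1; lra. }
    apply Rabs_def2 in Hb; lra. }
  assert (0 <= RInt g a c) by (apply RInt_ge_0; auto; [lra|now apply ex_RInt_cont]).
  assert (0 <= RInt g e b) by (apply RInt_ge_0; auto; [lra|now apply ex_RInt_cont]).
  rewrite (RInt_split g a c b), (RInt_split g c e b) in HI by exact Hc.
  lra.
Qed.

Lemma constant_of_derive_zero (a b : R) (f : R -> R) :
  (forall s, continuous f s) -> (forall s, a < s < b -> is_derive f s 0) ->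
  forall t, a <= t <= b -> f t = f a.
Proof.
  intros Hc Hd t Ht.
  destruct (Req_dec t a) as [->|Hne]; [reflexivity|].
  destruct (MVT_gen f a t (fun _ => 0)) as [c [_ Hm]].
  - rewrite Rmin_left, Rmax_right by lra; intros x Hx; apply Hd; lra.
  - intros x _; apply continuity_pt_filterlim, Hc.
  - lra.
Qed.

Lemma constant_of_derive_zero_line (f : R -> R) :
  (forall x, is_derive f x 0) -> forall x y, f x = f y.
Proof.
  intros Hd x y.
  destruct (MVT_gen f x y (fun _ => 0)) as [c [_ Hm]]; [now auto| |lra].
  intros z _; apply continuity_pt_filterlim.
  exact (is_derive_continuous _ _ _ (Hd z)).
Qed.

Definition C1_line (v : R -> R) : Prop :=
  exists v', (forall x, is_derive v x (v' x)) /\ (forall x, continuous v' x).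

Lemma C1_line_continuous (v : R -> R) (x : R) : C1_line v -> continuous v x.
Proof. intros (v' & Hd & _); exact (is_derive_continuous _ _ _ (Hd x)). Qed.

Lemma C1_line_ext (v w : R -> R) :
  (forall x, v x = w x) -> C1_line v -> C1_line w.
Proof.
  intros He (v' & Hd & Hc); exists v'; split; [|exact Hc].
  intros x; exact (is_derive_ext v w x _ He (Hd x)).
Qed.

Lemma smooth_C1_line (f : R -> R) (n : nat) : smooth f -> C1_line (Derive_n f n).
Proof.
  intros Hf; exists (Derive_n f (S n)); split; intros x.
  - exact (Derive_correct (Derive_n f n) x (Hf (S n) x)).
  - exact (ex_derive_continuous (Derive_n f (S n)) x (Hf (S (S n)) x)).
Qed.

Lemma smooth_is_derive (f : R -> R) (x : R) :
  smooth f -> is_derive f x (Derive f x).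
Proof. intros Hf; exact (Derive_correct f x (Hf 1%nat x)). Qed.

Lemma smooth_Derive_C1 (f : R -> R) : smooth f -> C1_line (Derive f).
Proof. exact (smooth_C1_line f 1). Qed.

Lemma C1_line_lin (v w : R -> R) (k : R) :
  C1_line v -> C1_line w -> C1_line (fun x => v x + k * w x).
Proof.
  intros (v' & Hv & Hv') (w' & Hw & Hw').
  exists (fun x => v' x + k * w' x); split; intros x.
  - apply (is_derive_plus v (fun x => k * w x)); [apply Hv|].
    apply is_derive_scal, Hw.
  - apply continuous_Rplus; [|apply continuous_Rscal]; auto.
Qed.

Lemma C1_line_opp (v : R -> R) : C1_line v -> C1_line (fun x => - v x).
Proof.
  intros (v' & Hd & Hc); exists (fun x => - v' x); split; intros x.
  - apply (is_derive_opp v), Hd.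
  - apply (continuous_opp v'), Hc.
Qed.

(** * D'Alembert's formula on the strip *)

Lemma partial_t_interior (T : R) (g gt : R * R -> R) (t x : R) :
  partial_t T g gt -> 0 < t < T ->
  is_derive (fun s => g (s, x)) t (gt (t, x)).
Proof.
  intros H Ht; apply (is_derive_of_within (fun s => 0 <= s <= T)).
  - now apply locally_interior.
  - apply H; unfold strip; simpl; lra.
Qed.

Lemma locally_2d_strip (T t x : R) (P : R -> R -> Prop) :
  0 < t < T -> (forall s y, 0 < s < T -> P s y) -> locally_2d P t x.
Proof.
  intros Ht H.
  assert (Hp : 0 < Rmin t (T - t)) by (apply Rmin_case; lra).
  exists (mkposreal _ Hp); simpl; intros s y Hs _; apply H.
  pose proof (Rmin_l t (T - t)); pose proof (Rmin_r t (T - t)).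
  apply Rabs_def2 in Hs; lra.
Qed.

Lemma continuity_2d_strip (T t x : R) (g : R * R -> R) (h : R -> R -> R) :
  0 < t < T -> continuous_on (strip T) g ->
  (forall s y, 0 < s < T -> h s y = g (s, y)) ->
  continuity_2d_pt h t x.
Proof.
  intros Ht Hg Hh.
  apply continuity_2d_pt_ext_loc with (fun s y => g (s, y)).
  { apply (locally_2d_strip T); [exact Ht|].
    intros s y Hs; symmetry; now apply Hh. }
  apply continuity_2d_pt_filterlim.
  change (continuous (fun z : R * R => g (fst z, snd z)) (t, x)).
  apply (continuous_ext g); [now intros [s y]|].
  apply (continuous_continuous_on (strip T)); [|exact Hg].
  apply (locally_2d_locally (fun s _ => 0 <= s <= T)).
  apply (locally_2d_strip T); [exact Ht|]; intros; lra.
Qed.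

Lemma is_derive_along_line (T : R) (g gt gx : R * R -> R) (s c sigma : R) :
  partial_t T g gt -> partial_x T g gx -> continuous_on (strip T) gt ->
  0 < s < T ->
  is_derive (fun r => g (r, c + sigma * r)) s
    (gt (s, c + sigma * s) + sigma * gx (s, c + sigma * s)).
Proof.
  intros Ht Hx Hc Hs.
  apply is_derive_Reals.
  replace (gt (s, c + sigma * s) + sigma * gx (s, c + sigma * s)) with
    (gt (s, c + sigma * s) * 1 + gx (s, c + sigma * s) * sigma) by ring.
  apply (derivable_pt_lim_comp_2d (fun a b => g (a, b)) (fun r => r)
           (fun r => c + sigma * r)).
  - apply filterdiff_differentiable_pt_lim.
    apply (is_derive_filterdiff (fun a b => g (a, b)) s (c + sigma * s)
             (fun a b => gt (a, b)) (gx (s, c + sigma * s))).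
    + apply (locally_2d_locally
               (fun a b => is_derive (fun z => g (z, b)) a (gt (a, b)))).
      apply (locally_2d_strip T); [exact Hs|].
      intros a b Ha; now apply (partial_t_interior T).
    + apply Hx; unfold strip; simpl; lra.
    + apply (continuity_2d_pt_filterlim (fun a b => gt (a, b))).
      now apply (continuity_2d_strip T s _ gt).
  - apply derivable_pt_lim_id.
  - apply is_derive_Reals; auto_derive; [exact I|ring].
Qed.

(** Schwarz's theorem, used in the interior of the strip, where the one-sided
    derivatives are ordinary ones. *)
Lemma mixed_partials_equal (T : R) (u ut ux utx uxt : R * R -> R) (t x : R) :
  partial_t T u ut -> partial_x T u ux ->
  partial_x T ut utx -> partial_t T ux uxt ->
  continuous_on (strip T) utx -> continuous_on (strip T) uxt ->
  0 < t < T -> utx (t, x) = uxt (t, x).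
Proof.
  intros Ht Hx Htx Hxt Hc1 Hc2 Hi.
  assert (Hs : forall s y, 0 < s < T -> strip T (s, y))
    by (intros; unfold strip; simpl; lra).
  assert (Dt : forall s y, 0 < s < T -> Derive (fun z => u (z, y)) s = ut (s, y)).
  { intros s y Hs1; apply is_derive_unique; now apply (partial_t_interior T). }
  assert (Dx : forall s y, 0 < s < T -> Derive (fun z => u (s, z)) y = ux (s, y)).
  { intros s y Hs1; apply is_derive_unique, Hx; auto. }
  assert (Dxt : forall s y, 0 < s < T ->
    is_derive (fun z => Derive (fun w => u (z, w)) y) s (uxt (s, y))).
  { intros s y Hs1.
    apply is_derive_ext_loc with (fun z => ux (z, y)).
    - assert (Hl : locally_2d (fun a _ => ux (a, y) = Derive (fun w => u (a, w)) y)
                     s y).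
      { apply (locally_2d_strip T); [exact Hs1|].
        intros a b Ha; symmetry; now apply Dx. }
      apply locally_2d_1d_const_y in Hl; exact Hl.
    - now apply (partial_t_interior T). }
  assert (Dtx : forall s y, 0 < s < T ->
    is_derive (fun z => Derive (fun w => u (w, z)) s) y (utx (s, y))).
  { intros s y Hs1.
    apply is_derive_ext with (fun z => ut (s, z)).
    - intros z; symmetry; now apply Dt.
    - apply Htx; auto. }
  transitivity (Derive (fun z => Derive (fun w => u (w, z)) t) x).
  { symmetry; exact (is_derive_unique _ _ _ (Dtx t x Hi)). }
  transitivity (Derive (fun z => Derive (fun w => u (z, w)) x) t).
  2: exact (is_derive_unique _ _ _ (Dxt t x Hi)).
  symmetry; apply (Schwarz (fun a b => u (a, b))).
  - apply (locally_2d_strip T); [exact Hi|]; intros s y Hs1.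
    repeat split.
    + exists (ut (s, y)); now apply (partial_t_interior T).
    + exists (ux (s, y)); apply Hx; auto.
    + exists (uxt (s, y)); now apply Dxt.
    + exists (utx (s, y)); now apply Dtx.
  - apply (continuity_2d_strip T t x uxt); [exact Hi|exact Hc2|].
    intros s y Hs1; apply is_derive_unique; now apply Dxt.
  - apply (continuity_2d_strip T t x utx); [exact Hi|exact Hc1|].
    intros s y Hs1; apply is_derive_unique; now apply Dtx.
Qed.

Lemma is_derive_clamped_line (T : R) (g gt gx : R * R -> R) (s c sigma : R) :
  partial_t T g gt -> partial_x T g gx -> continuous_on (strip T) gt ->
  0 < s < T ->
  is_derive (fun r => g (clamp 0 T r, c + sigma * r)) s
    (gt (s, c + sigma * s) + sigma * gx (s, c + sigma * s)).
Proof.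
  intros Ht Hx Hc Hs.
  apply is_derive_ext_loc with (fun r => g (r, c + sigma * r)).
  - generalize (locally_interior 0 T s Hs); apply filter_imp.
    intros r Hr; now rewrite clamp_id.
  - now apply (is_derive_along_line T).
Qed.

Lemma continuous_clamped_line (T : R) (g : R * R -> R) (c sigma s : R) :
  0 <= T -> continuous_on (strip T) g ->
  continuous (fun r => g (clamp 0 T r, c + sigma * r)) s.
Proof.
  intros hT Hg.
  apply (continuous_clamp_comp T g (fun r => r) (fun r => c + sigma * r));
    [exact hT|exact Hg|apply continuous_id|].
  apply continuous_Rplus; [apply continuous_const|].
  apply continuous_Rscal, continuous_id.
Qed.

Lemma wave_equation_interior (T : R) (u ut ux utt uxx : R * R -> R) (t x : R) :
  wave_equation T u -> partial_t T u ut -> partial_x T u ux ->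
  partial_t T ut utt -> partial_x T ux uxx -> 0 < t < T ->
  utt (t, x) = uxx (t, x).
Proof.
  intros (wt & wtt & wx & wxx & Ht & Htt & Hx & Hxx & Hw) Kt Kx Ktt Kxx Hi.
  assert (Hp : strip T (t, x)) by (unfold strip; simpl; lra).
  specialize (Hw _ Hp).
  replace (utt (t, x)) with (wtt (t, x)); [replace (uxx (t, x)) with (wxx (t, x))|].
  - lra.
  - rewrite <- (is_derive_unique (fun y => ux (t, y)) x _ (Kxx t x Hp)).
    symmetry; apply is_derive_unique.
    apply is_derive_ext with (fun y => wx (t, y)); [|now apply Hxx].
    intros y; rewrite <- (is_derive_unique _ _ _ (Hx t y Hp)).
    apply is_derive_unique; now apply Kx.
  - rewrite <- (is_derive_unique (fun s => ut (s, x)) t _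
                 (partial_t_interior T _ _ t x Ktt Hi)).
    symmetry; apply is_derive_unique.
    apply is_derive_ext_loc with (fun s => wt (s, x)).
    2: now apply (partial_t_interior T).
    assert (Hl : locally_2d (fun s _ => wt (s, x) = ut (s, x)) t x).
    { apply (locally_2d_strip T); [exact Hi|]; intros s y Hs.
      rewrite <- (is_derive_unique _ _ _ (partial_t_interior T _ _ s x Ht Hs)).
      apply is_derive_unique; now apply (partial_t_interior T). }
    apply locally_2d_1d_const_y in Hl; exact Hl.
Qed.

Lemma input_eq_ut (T : R) (u ut : R * R -> R) (v : R -> R) :
  0 < T -> partial_t T u ut -> has_input T u v -> forall x, v x = ut (0, x).
Proof.
  intros hT Ht Hv x.
  apply (is_derive_within_unique_left T (fun s => u (s, x)) (fun s => u (s, x)));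
    [exact hT|reflexivity|apply Hv|].
  apply Ht; unfold strip; simpl; lra.
Qed.

Lemma input_C1 (T : R) (u : R * R -> R) (v : R -> R) :
  0 < T -> C2_strip T u -> has_input T u v -> C1_line v.
Proof.
  intros hT (_ & ut & ux & Ht & _ & (_ & utt & utx & _ & Htx & _ & Hc) & _) Hv.
  apply C1_line_ext with (fun x => ut (0, x)).
  { intros x; symmetry; now apply (input_eq_ut T u ut v). }
  exists (fun x => utx (0, x)); split; intros x.
  - apply Htx; unfold strip; simpl; lra.
  - apply continuous_ext with (fun x => utx (clamp 0 T 0, x)).
    { intros y; rewrite clamp_id by lra; reflexivity. }
    apply (continuous_clamp_comp T utx (fun _ => 0) (fun r => r));
      [lra|exact Hc|apply continuous_const|apply continuous_id].
Qed.

(** The coefficients [1] and [-1] keep the arguments in the form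
    [c + sigma * s] of points on characteristic lines. *)
Definition travelling (F G : R -> R) (p : R * R) : R :=
  F (snd p + 1 * fst p) + G (snd p + (-1) * fst p).

Definition dAlembert (f0 v : R -> R) : R * R -> R :=
  travelling (fun y => / 2 * (f0 y + RInt v 0 y))
             (fun y => / 2 * (f0 y + (-1) * RInt v 0 y)).

(** The operator factors as [(d_t - d_x)(d_t + d_x)]: the first factor makes
    [u_t + u_x] constant on the lines [x + t = c], hence equal to
    [v + f0'] at the foot of the line; integrating this along the lines
    [x - t = c] gives [u]. Both derivatives are taken in the interior of the
    strip only, and reach its boundary by continuity. *)
Lemma dAlembert_formula (f0 fT : R -> R) (T : R) (u : R * R -> R) (v : R -> R) :
  0 < T -> smooth f0 -> is_solution f0 fT T u -> has_input T u v ->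
  eq_on_strip T u (dAlembert f0 v).
Proof.
  intros hT Hf0 (HC2 & Hw & Hu0 & _) Hv.
  pose (V := fun y => RInt v 0 y).
  assert (HV : forall x, is_derive V x (v x)).
  { intros x; apply is_derive_primitive; intros y.
    now apply C1_line_continuous, (input_C1 T u). }
  destruct HC2 as (Hcu & ut & ux & Ht & Hx &
    (Hct & utt & utx & Htt & Htx & Hctt & Hctx) &
    (Hcx & uxt & uxx & Hxt & Hxx & Hcxt & Hcxx)).
  assert (Hchar : forall t x, 0 <= t <= T ->
    ut (t, x) + ux (t, x) = v (x + t) + Derive f0 (x + t)).
  { intros t x Hti.
    pose (phi := fun r => ut (clamp 0 T r, (x + t) + (-1) * r) +
                          ux (clamp 0 T r, (x + t) + (-1) * r)).
    assert (Hphi : phi t = phi 0).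
    { apply (constant_of_derive_zero 0 T); [| |exact Hti].
      - intros s; apply continuous_Rplus; apply continuous_clamped_line;
          auto; lra.
      - intros s Hs; unfold phi.
        set (y := x + t + -1 * s).
        apply is_derive_value with ((utt (s, y) + (-1) * utx (s, y)) +
                                    (uxt (s, y) + (-1) * uxx (s, y))).
        + apply (is_derive_plus
            (fun r => ut (clamp 0 T r, (x + t) + (-1) * r))
            (fun r => ux (clamp 0 T r, (x + t) + (-1) * r)));
            apply is_derive_clamped_line; auto.
        + rewrite (mixed_partials_equal T u ut ux utx uxt s y) by auto.
          rewrite (wave_equation_interior T u ut ux utt uxx s y) by auto.
          ring. }
    unfold phi in Hphi.
    rewrite !clamp_id in Hphi by lra.
    replace (x + t + -1 * t) with x in Hphi by ring.
    replace (x + t + -1 * 0) with (x + t) in Hphi by ring.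
    rewrite Hphi, (input_eq_ut T u ut v) by auto; f_equal.
    rewrite <- (is_derive_unique (fun y => u (0, y)) (x + t) (ux (0, x + t))).
    - apply Derive_ext; auto.
    - apply Hx; unfold strip; simpl; lra. }
  intros [t x] Hti; unfold strip in Hti; simpl in Hti.
  set (c := x - t).
  pose (psi := fun r => u (clamp 0 T r, c + 1 * r)
                        - / 2 * (V (c + 2 * r) + f0 (c + 2 * r))).
  assert (Hprim : forall r, is_derive
     (fun r => / 2 * (V (c + 2 * r) + f0 (c + 2 * r))) r
     (v (c + 2 * r) + Derive f0 (c + 2 * r))).
  { intros r.
    replace (v (c + 2 * r) + Derive f0 (c + 2 * r)) with
      (/ 2 * (2 * (v (c + 2 * r) + Derive f0 (c + 2 * r)))) by field.
    apply is_derive_scal.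
    apply (is_derive_comp (fun y => V y + f0 y) (fun r => c + 2 * r)).
    - apply (is_derive_plus V f0); [apply HV|now apply smooth_is_derive].
    - auto_derive; [exact I|ring]. }
  assert (Hpsi : psi t = psi 0).
  { apply (constant_of_derive_zero 0 T); [| |exact Hti].
    - intros s; apply continuous_Rminus.
      + apply continuous_clamped_line; [lra|exact Hcu].
      + exact (is_derive_continuous _ _ _ (Hprim s)).
    - intros s Hs; unfold psi.
      apply is_derive_value with ((ut (s, c + 1 * s) + 1 * ux (s, c + 1 * s)) -
                                  (v (c + 2 * s) + Derive f0 (c + 2 * s))).
      + apply (is_derive_minus (fun r => u (clamp 0 T r, c + 1 * r))).
        * apply is_derive_clamped_line; auto.
        * apply Hprim.
      + pose proof (Hchar s (c + 1 * s) ltac:(lra)) as E.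
        replace (c + 1 * s + s) with (c + 2 * s) in E by ring; lra. }
  unfold psi in Hpsi; rewrite !clamp_id in Hpsi by lra.
  rewrite Hu0 in Hpsi.
  unfold dAlembert, travelling; simpl; fold (V (x + 1 * t)) (V (x + -1 * t)).
  replace (c + 1 * t) with x in Hpsi by (unfold c; ring).
  replace (c + 2 * t) with (x + 1 * t) in Hpsi by (unfold c; ring).
  replace (c + 2 * 0) with (x + -1 * t) in Hpsi by (unfold c; ring).
  replace (c + 1 * 0) with (x + -1 * t) in Hpsi by (unfold c; ring).
  lra.
Qed.

Lemma solution_determined_by_input (f0 fT : R -> R) (T : R)
  (u w : R * R -> R) (v : R -> R) :
  0 < T -> smooth f0 ->
  is_solution f0 fT T u -> has_input T u v ->
  is_solution f0 fT T w -> has_input T w v -> eq_on_strip T u w.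
Proof.
  intros hT Hf0 Hu Hv Hw Hv' p Hp.
  rewrite (dAlembert_formula f0 fT T u v) by auto.
  symmetry; now apply (dAlembert_formula f0 fT T w v).
Qed.

Lemma input_determined_by_solution (T : R) (u w : R * R -> R) (v v' : R -> R) :
  0 < T -> has_input T u v -> has_input T w v' -> eq_on_strip T u w ->
  forall x, v x = v' x.
Proof.
  intros hT Hv Hw He x.
  apply (is_derive_within_unique_left T (fun s => u (s, x)) (fun s => w (s, x)));
    [exact hT| |apply Hv|apply Hw].
  intros s Hs; apply He; exact Hs.
Qed.

(** * The input space *)

(** The functions [v] for which d'Alembert's formula gives a function of class
    C2 with [u (T, x) = fT x]. *)
Definition admissible (f0 fT : R -> R) (T : R) (v : R -> R) : Prop :=
  C1_line v /\
  forall x, RInt v (x - T) (x + T) = 2 * fT x - f0 (x + T) - f0 (x - T).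

Lemma input_admissible (f0 fT : R -> R) (T : R) (u : R * R -> R) (v : R -> R) :
  0 < T -> smooth f0 -> is_solution f0 fT T u -> has_input T u v ->
  admissible f0 fT T v.
Proof.
  intros hT Hf0 Hu Hv.
  assert (HC1 : C1_line v) by (apply (input_C1 T u); auto; apply Hu).
  split; [exact HC1|]; intros x.
  assert (Hc : forall y, continuous v y)
    by (intros y; now apply C1_line_continuous).
  pose (V := fun y => RInt v 0 y).
  assert (HV : forall y, is_derive V y (v y))
    by (intros y; now apply is_derive_primitive).
  rewrite (RInt_primitive v V) by auto.
  pose proof (dAlembert_formula f0 fT T u v hT Hf0 Hu Hv (T, x)) as H.
  destruct Hu as (_ & _ & _ & HuT).
  rewrite HuT in H; unfold dAlembert, travelling in H; simpl in H.
  replace (x + 1 * T) with (x + T) in H by ring.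
  replace (x + -1 * T) with (x - T) in H by ring.
  fold (V (x + T)) (V (x - T)) in H.
  unfold strip in H; simpl in H; lra.
Qed.

Lemma travelling_continuous (F G : R -> R) (p : R * R) :
  (forall x, continuous F x) -> (forall x, continuous G x) ->
  continuous (travelling F G) p.
Proof.
  intros HF HG; destruct p as [t x].
  apply continuous_Rplus; apply continuous_compose; auto;
  (apply continuous_Rplus; [apply (continuous_snd t x)|];
   apply continuous_Rscal; apply (continuous_fst t x)).
Qed.

Lemma travelling_partial_t (T : R) (F F' G G' : R -> R) :
  (forall x, is_derive F x (F' x)) -> (forall x, is_derive G x (G' x)) ->
  partial_t T (travelling F G) (travelling F' (fun x => - G' x)).
Proof.
  intros HF HG t x Hp; apply is_derive_within_of_is_derive; [exact Hp|].
  unfold travelling; simpl.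
  replace (F' (x + 1 * t) + - G' (x + -1 * t)) with
    (1 * F' (x + 1 * t) + (-1) * G' (x + -1 * t)) by ring.
  apply (is_derive_plus (fun s => F (x + 1 * s)) (fun s => G (x + -1 * s)));
    now apply is_derive_affine.
Qed.

Lemma travelling_partial_x (T : R) (F F' G G' : R -> R) :
  (forall x, is_derive F x (F' x)) -> (forall x, is_derive G x (G' x)) ->
  partial_x T (travelling F G) (travelling F' G').
Proof.
  intros HF HG t x Hp; unfold travelling; simpl.
  assert (Hshift : forall (H H' : R -> R) c, (forall y, is_derive H y (H' y)) ->
    is_derive (fun y => H (y + c)) x (H' (x + c))).
  { intros H H' c Hd.
    replace (H' (x + c)) with (1 * H' (x + c)) by ring.
    apply (is_derive_comp H (fun y => y + c)); [apply Hd|].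
    auto_derive; [exact I|ring]. }
  apply (is_derive_plus (fun y => F (y + 1 * t)) (fun y => G (y + -1 * t)));
    now apply Hshift.
Qed.

Lemma travelling_C1 (T : R) (F G : R -> R) :
  C1_line F -> C1_line G -> C1_strip T (travelling F G).
Proof.
  intros HF HG.
  destruct HF as (F' & HF & HF'), HG as (G' & HG & HG').
  assert (HcF : forall x, continuous F x)
    by (intros x; exact (is_derive_continuous _ _ _ (HF x))).
  assert (HcG : forall x, continuous G x)
    by (intros x; exact (is_derive_continuous _ _ _ (HG x))).
  assert (HNG' : forall x, continuous (fun y => - G' y) x)
    by (intros x; apply (continuous_opp G'), HG').
  split.
  { apply continuous_on_of_continuous; intros p; now apply travelling_continuous. }
  exists (travelling F' (fun x => - G' x)), (travelling F' G').
  split; [now apply travelling_partial_t|].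
  split; [now apply travelling_partial_x|].
  split; apply continuous_on_of_continuous; intros p;
    now apply travelling_continuous.
Qed.

Lemma travelling_wave (T : R) (F F' G G' : R -> R) :
  (forall x, is_derive F x (F' x)) -> (forall x, is_derive G x (G' x)) ->
  C1_line F' -> C1_line G' ->
  C2_strip T (travelling F G) /\ wave_equation T (travelling F G).
Proof.
  intros HF HG HF' HG'.
  pose proof HF' as (F'' & HF'' & HF2c); pose proof HG' as (G'' & HG'' & HG2c).
  assert (HcF : forall x, continuous F x)
    by (intros x; exact (is_derive_continuous _ _ _ (HF x))).
  assert (HcG : forall x, continuous G x)
    by (intros x; exact (is_derive_continuous _ _ _ (HG x))).
  split.
  - split.
    { apply continuous_on_of_continuous; intros p.
      now apply travelling_continuous. }
    exists (travelling F' (fun x => - G' x)), (travelling F' G').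
    split; [now apply travelling_partial_t|].
    split; [now apply travelling_partial_x|].
    split; apply travelling_C1; auto; now apply C1_line_opp.
  - exists (travelling F' (fun x => - G' x)),
      (travelling F'' (fun x => - - G'' x)),
      (travelling F' G'), (travelling F'' G'').
    split; [now apply travelling_partial_t|].
    split.
    { apply travelling_partial_t; [exact HF''|].
      intros x; apply (is_derive_opp G'), HG''. }
    split; [now apply travelling_partial_x|].
    split; [now apply travelling_partial_x|].
    intros p _; unfold travelling; ring.
Qed.

Lemma dAlembert_solution (f0 fT : R -> R) (T : R) (v : R -> R) :
  0 < T -> smooth f0 -> admissible f0 fT T v ->
  is_solution f0 fT T (dAlembert f0 v) /\ has_input T (dAlembert f0 v) v.
Proof.
  intros hT Hf0 [HC1 HI].
  assert (Hc : forall y, continuous v y)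
    by (intros y; now apply C1_line_continuous).
  pose (V := fun y => RInt v 0 y).
  assert (HV : forall y, is_derive V y (v y))
    by (intros y; now apply is_derive_primitive).
  pose (F := fun y => / 2 * (f0 y + V y)).
  pose (G := fun y => / 2 * (f0 y + (-1) * V y)).
  assert (HF : forall x, is_derive F x (/ 2 * (Derive f0 x + v x))).
  { intros x; apply is_derive_scal, (is_derive_plus f0 V);
      [now apply smooth_is_derive|apply HV]. }
  assert (HG : forall x, is_derive G x (/ 2 * (Derive f0 x + (-1) * v x))).
  { intros x; apply is_derive_scal, (is_derive_plus f0 (fun y => (-1) * V y));
      [now apply smooth_is_derive|apply is_derive_scal, HV]. }
  assert (Hhalf : forall k, C1_line (fun x => / 2 * (Derive f0 x + k * v x))).
  { intros k.
    apply C1_line_ext with (fun x => (/ 2 * Derive f0 x) + / 2 * (k * v x)).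
    { intros; ring. }
    assert (H0 : C1_line (fun _ => 0)).
    { exists (fun _ => 0); split; intros; [apply @is_derive_const|
      apply continuous_const]. }
    apply (C1_line_lin (fun x => / 2 * Derive f0 x) (fun x => k * v x)).
    - apply C1_line_ext with (fun x => 0 + / 2 * Derive f0 x); [intros; ring|].
      apply C1_line_lin; [exact H0|now apply smooth_Derive_C1].
    - apply C1_line_ext with (fun x => 0 + k * v x); [intros; ring|].
      now apply C1_line_lin. }
  destruct (travelling_wave T F _ G _ HF HG) as [H2 Hw].
  { apply C1_line_ext with (2 := Hhalf 1); intros; ring. }
  { apply Hhalf. }
  change (dAlembert f0 v) with (travelling F G).
  split; [split; [exact H2|split; [exact Hw|split]]|].
  - intros x; unfold travelling, F, G; simpl.
    replace (x + 1 * 0) with x by ring; replace (x + -1 * 0) with x by ring.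
    field.
  - intros x; unfold travelling, F, G; simpl.
    replace (x + 1 * T) with (x + T) by ring.
    replace (x + -1 * T) with (x - T) by ring.
    specialize (HI x); rewrite (RInt_primitive v V) in HI by auto; lra.
  - intros x.
    replace (v x) with (travelling (fun x => / 2 * (Derive f0 x + v x))
      (fun x => - (/ 2 * (Derive f0 x + (-1) * v x))) (0, x)).
    + apply (travelling_partial_t T F _ G _ HF HG 0 x).
      unfold strip; simpl; lra.
    + unfold travelling; simpl.
      replace (x + 1 * 0) with x by ring; replace (x + -1 * 0) with x by ring.
      field.
Qed.

Lemma input_space_iff (f0 fT : R -> R) (T : R) (v : R -> R) :
  0 < T -> smooth f0 -> (input_space f0 fT T v <-> admissible f0 fT T v).
Proof.
  intros hT Hf0; split.
  - intros (u & Hu & Hv); now apply (input_admissible f0 fT T u).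
  - intros Hv; exists (dAlembert f0 v); now apply dAlembert_solution.
Qed.

(** The derivative of the right-hand side of the integral condition. *)
Definition jump (f0 fT : R -> R) (T x : R) : R :=
  2 * Derive fT x - Derive f0 (x + T) - Derive f0 (x - T).

Lemma C1_line_jump (f0 fT : R -> R) (T : R) :
  smooth f0 -> smooth fT ->
  exists k', (forall x, is_derive (jump f0 fT T) x (k' x)) /\
    (forall x, continuous k' x) /\ k' 0 = const_c2 f0 fT T.
Proof.
  intros H0 HT.
  destruct (smooth_Derive_C1 f0 H0) as (g0 & Hg0 & Hc0).
  destruct (smooth_Derive_C1 fT HT) as (gT & HgT & HcT).
  exists (fun x => 2 * gT x - g0 (x + T) - g0 (x + - T)); split; [|split].
  - intros x; apply is_derive_Rminus.
    + apply is_derive_Rminus; [apply is_derive_scal, HgT|].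
      now apply is_derive_shift.
    + now apply is_derive_shift.
  - intros x; repeat apply continuous_Rminus;
      [now apply continuous_Rscal| |]; now apply continuous_shift.
  - unfold const_c2.
    rewrite Rplus_0_l, Rplus_0_l.
    change (2 * gT 0 - g0 T - g0 (- T) = 2 * Derive (Derive fT) 0 -
            Derive (Derive f0) T - Derive (Derive f0) (- T)).
    rewrite (is_derive_unique _ _ _ (HgT 0)), (is_derive_unique _ _ _ (Hg0 T)).
    rewrite (is_derive_unique _ _ _ (Hg0 (- T))); reflexivity.
Qed.

(** Differentiating the integral condition in [x] leaves its value at [x = 0]
    and a difference equation of step [2 * T]. *)
Lemma admissible_iff (f0 fT : R -> R) (T : R) (v : R -> R) :
  smooth f0 -> smooth fT ->
  (admissible f0 fT T v <->
   C1_line v /\ RInt v (- T) T = const_A f0 fT T /\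
   forall x, v (x + T) - v (x - T) = jump f0 fT T x).
Proof.
  intros H0 HT.
  assert (Hd : C1_line v -> forall x,
    is_derive (fun x => RInt v (x - T) (x + T) -
                        (2 * fT x - f0 (x + T) - f0 (x - T))) x
      (v (x + T) - v (x - T) - jump f0 fT T x)).
  { intros HC1 x.
    assert (Hc : forall y, continuous v y)
      by (intros y; now apply C1_line_continuous).
    pose (V := fun y => RInt v 0 y).
    assert (HV : forall y, is_derive V y (v y))
      by (intros y; now apply is_derive_primitive).
    apply is_derive_ext with (fun x => (V (x + T) - V (x + - T)) -
                        (2 * fT x - f0 (x + T) - f0 (x + - T))).
    { intros t; now rewrite (RInt_primitive v V). }
    apply is_derive_Rminus.
    - apply is_derive_Rminus; now apply is_derive_shift.
    - apply is_derive_Rminus; [apply is_derive_Rminus|].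
      + apply is_derive_scal; now apply smooth_is_derive.
      + apply (is_derive_shift f0 (Derive f0)).
        intros y; now apply smooth_is_derive.
      + apply (is_derive_shift f0 (Derive f0)).
        intros y; now apply smooth_is_derive. }
  split.
  - intros [HC1 HI]; split; [exact HC1|split].
    + specialize (HI 0); rewrite Rplus_0_l, Rminus_0_l in HI.
      exact HI.
    + intros x.
      apply Rminus_diag_uniq.
      rewrite <- (is_derive_unique _ _ _ (Hd HC1 x)).
      rewrite <- (Derive_const 0 x) at 1.
      apply Derive_ext; intros t; rewrite HI; ring.
  - intros (HC1 & HA & Hj); split; [exact HC1|]; intros x.
    apply Rminus_diag_uniq.
    rewrite (constant_of_derive_zero_line
      (fun x => RInt v (x - T) (x + T) - (2 * fT x - f0 (x + T) - f0 (x - T))))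
      with (y := 0).
    + rewrite Rplus_0_l, Rminus_0_l, HA; unfold const_A; ring.
    + intros y; apply is_derive_value with (1 := Hd HC1 y).
      rewrite Hj; ring.
Qed.

(** * Extension from one period to the line *)

Lemma period_induction (T : R) (P : R -> Prop) :
  0 < T ->
  (forall x, - T <= x < T -> P x) ->
  (forall x, P x -> P (x + 2 * T)) -> (forall x, P x -> P (x - 2 * T)) ->
  forall x, P x.
Proof.
  intros hT H0 Hp Hm x.
  assert (Hz : forall z y, P y -> P (y + 2 * T * IZR z)).
  { intros z y Hy; induction z as [|z IH|z IH] using Z.peano_ind.
    - replace (y + 2 * T * 0) with y by ring; exact Hy.
    - rewrite succ_IZR; replace (y + 2 * T * (IZR z + 1)) with
        (y + 2 * T * IZR z + 2 * T) by ring; now apply Hp.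
    - unfold Z.pred; rewrite plus_IZR.
      replace (y + 2 * T * (IZR z + -1)) with
        (y + 2 * T * IZR z - 2 * T) by ring; now apply Hm. }
  set (z := Int_part ((x + T) / (2 * T))).
  replace x with (x - 2 * T * IZR z + 2 * T * IZR z) by ring.
  apply Hz, H0.
  destruct (base_Int_part ((x + T) / (2 * T))) as [B1 B2]; fold z in B1, B2.
  apply (Rmult_le_compat_l (2 * T)) in B1; [|lra].
  apply (Rmult_gt_compat_l (2 * T)) in B2; [|lra].
  rewrite Rmult_minus_distr_l in B2.
  replace (2 * T * ((x + T) / (2 * T))) with (x + T) in B1, B2 by (field; lra).
  lra.
Qed.

Fixpoint partial_sum (g : nat -> R) (n : nat) : R :=
  match n with O => 0 | S m => partial_sum g m + g m end.

(** The values at negative integers are those forced by the recurrence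
    [Z_sum g (z + 1) = Z_sum g z + g z] from [Z_sum g 0 = 0]. *)
Definition Z_sum (g : Z -> R) (z : Z) : R :=
  partial_sum (fun i => g (Z.of_nat i)) (Z.to_nat z) -
  partial_sum (fun i => g (- 1 - Z.of_nat i)%Z) (Z.to_nat (- z)).

Lemma Z_sum_succ (g : Z -> R) (z : Z) : Z_sum g (z + 1) = Z_sum g z + g z.
Proof.
  unfold Z_sum; destruct (Z_lt_le_dec z 0) as [Hz|Hz].
  - replace (Z.to_nat (- z)) with (S (Z.to_nat (- (z + 1)))) by lia.
    replace (Z.to_nat (z + 1)) with 0%nat by lia.
    replace (Z.to_nat z) with 0%nat by lia; cbn [partial_sum].
    replace (- 1 - Z.of_nat (Z.to_nat (- (z + 1))))%Z with z by lia; ring.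
  - replace (Z.to_nat (z + 1)) with (S (Z.to_nat z)) by lia.
    replace (Z.to_nat (- (z + 1))) with 0%nat by lia.
    replace (Z.to_nat (- z)) with 0%nat by lia; cbn [partial_sum].
    replace (Z.of_nat (Z.to_nat z)) with z by lia; ring.
Qed.

(** Each [x] is [y + 2 * T * z] for a unique integer [z] and a unique [y] in
    [-T, T); the equation is summed over the [z] steps from [y] to [x]. The
    hypothesis on [b] says that the same value is found at the closed end
    [T]. *)
Lemma difference_equation_solution (T : R) (b k : R -> R) :
  0 < T -> b T - b (- T) = k 0 ->
  exists w : R -> R, (forall x, - T <= x <= T -> w x = b x) /\
    forall x, w (x + T) - w (x - T) = k x.
Proof.
  intros hT Hb.
  pose (S := fun y => Z_sum (fun z => k (y + (2 * IZR z + 1) * T))).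
  assert (HS : forall y, S y 0%Z = 0 /\
            forall z, S y (z + 1)%Z = S y z + k (y + (2 * IZR z + 1) * T)).
  { intros y; split; [apply Rminus_diag|intros z; apply Z_sum_succ]. }
  pose (n := fun x => Int_part ((x + T) / (2 * T))).
  pose (r := fun x => x - 2 * T * IZR (n x)).
  exists (fun x => b (r x) + S (r x) (n x)).
  assert (Hn : forall x z, - T <= x - 2 * T * IZR z < T -> n x = z).
  { intros x z Hz; unfold n; symmetry; apply Int_part_spec.
    assert (E : (x + T) / (2 * T) = IZR z + (x - 2 * T * IZR z + T) / (2 * T))
      by (field; lra).
    assert (E' : 0 <= (x - 2 * T * IZR z + T) / (2 * T) < 1).
    { split; [apply Rdiv_le_0_compat; lra|].
      apply Rmult_lt_reg_r with (2 * T); [lra|].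
      unfold Rdiv; rewrite Rmult_assoc, Rinv_l; lra. }
    lra. }
  split.
  - intros x Hx; destruct (Req_dec x T) as [->|Hne].
    + assert (En : n T = 1%Z) by (apply Hn; simpl; lra).
      unfold r; rewrite En.
      replace (T - 2 * T * 1) with (- T) by ring.
      destruct (HS (- T)) as [HS0 HS1].
      specialize (HS1 0%Z); simpl in HS1; rewrite HS1, HS0.
      replace (- T + (2 * 0 + 1) * T) with 0 by ring; lra.
    + assert (En : n x = 0%Z) by (apply Hn; simpl; lra).
      unfold r; rewrite En.
      replace (x - 2 * T * 0) with x by ring.
      rewrite (proj1 (HS x)); ring.
  - intros x.
    set (z := n (x - T)).
    assert (Hz : - T <= (x - T) - 2 * T * IZR z < T).
    { destruct (base_Int_part (((x - T) + T) / (2 * T))) as [B1 B2].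
      fold (n (x - T)) in B1, B2; fold z in B1, B2.
      apply (Rmult_le_compat_l (2 * T)) in B1; [|lra].
      apply (Rmult_gt_compat_l (2 * T)) in B2; [|lra].
      rewrite Rmult_minus_distr_l in B2.
      replace (2 * T * ((x - T + T) / (2 * T))) with x in B1, B2
        by (field; lra).
      lra. }
    assert (En : n (x + T) = (z + 1)%Z).
    { apply Hn; rewrite plus_IZR; lra. }
    unfold r; rewrite En; fold z; rewrite plus_IZR.
    replace (x + T - 2 * T * (IZR z + 1)) with (x - T - 2 * T * IZR z) by ring.
    rewrite (proj2 (HS (x - T - 2 * T * IZR z))).
    replace (x - T - 2 * T * IZR z + (2 * IZR z + 1) * T) with x by ring.
    ring.
Qed.

(** The equation carries continuity from [x] to [x + 2 * T] and back, so only
    one joint between consecutive periods has to be examined. *)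
Lemma continuous_extension (T : R) (b k : R -> R) :
  0 < T -> continuous_on (fun y => - T <= y <= T) b ->
  (forall x, continuous k x) -> b T - b (- T) = k 0 ->
  exists w : R -> R, (forall x, continuous w x) /\
    (forall x, - T <= x <= T -> w x = b x) /\
    forall x, w (x + T) - w (x - T) = k x.
Proof.
  intros hT Hb Hk Hbk.
  destruct (difference_equation_solution T b k hT Hbk) as (w & Hwb & Hw).
  exists w; split; [|now split].
  assert (Hstep : forall x : R, continuous w x -> continuous w (x - 2 * T)).
  { intros x Hx.
    apply continuous_Rext with (fun y => w (y + 2 * T) - k (y + T)).
    { intros y; rewrite <- Hw.
      replace (y + T + T) with (y + 2 * T) by ring.
      replace (y + T - T) with y by ring; ring. }
    apply continuous_Rminus; [|now apply continuous_shift].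
    apply (continuous_shift_at w (2 * T) x); [exact Hx|ring]. }
  (* on (-T, 3T) the two branches of w are glued by freezing each at the joint *)
  pose (glue := fun y =>
      b (clamp (- T) T y) + b (clamp (- T) T (y + - (2 * T))) - b (- T) +
      k (Rmax 0 (y - T)) - k 0).
  assert (Hglue : forall y : R, - T <= y <= 3 * T -> glue y = w y).
  { intros y Hy; unfold glue.
    destruct (Rle_dec y T) as [Hle|Hgt].
    - rewrite (clamp_id (- T) T y), Hwb by lra.
      replace (clamp (- T) T (y + - (2 * T))) with (- T).
      2: { unfold clamp; rewrite Rmin_right, Rmax_left; lra. }
      rewrite Rmax_left by lra; ring.
    - replace (clamp (- T) T y) with T.
      2: { unfold clamp; rewrite Rmin_left, Rmax_right; lra. }
      rewrite clamp_id, Rmax_right by lra.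
      specialize (Hw (y - T)).
      replace (y - T + T) with y in Hw by ring.
      replace (y - T - T) with (y + - (2 * T)) in Hw by ring.
      rewrite (Hwb (y + - (2 * T))) in Hw by lra; lra. }
  assert (Hmid : forall x : R, - T < x < 3 * T -> continuous w x).
  { intros x Hx.
    apply continuous_ext_loc with glue.
    - generalize (locally_interior _ _ _ Hx); apply filter_imp; exact Hglue.
    - apply continuous_Rminus; [|apply continuous_const].
      apply continuous_Rplus.
      + apply continuous_Rminus; [|apply continuous_const].
        apply continuous_Rplus.
        * apply (continuous_clamp b); [lra|exact Hb].
        * apply (continuous_shift (fun y => b (clamp (- T) T y))).
          intros y; apply (continuous_clamp b); [lra|exact Hb].
      + apply continuous_compose; [|apply Hk].
        apply continuous_Rmax0, continuous_Rminus;
          [apply continuous_id|apply continuous_const]. }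
  apply (period_induction T); [exact hT| | |exact Hstep].
  - intros x Hx; destruct (Req_dec x (- T)) as [->|Hne]; [|apply Hmid; lra].
    replace (- T) with (T - 2 * T) by ring; apply Hstep, Hmid; lra.
  - intros x Hx.
    apply continuous_Rext with (fun y => w (y - 2 * T) + k (y + - T)).
    { intros y; rewrite <- Hw.
      replace (y + - T + T) with y by ring.
      replace (y + - T - T) with (y - 2 * T) by ring; ring. }
    apply continuous_Rplus; [|now apply continuous_shift].
    apply (continuous_shift_at w (- (2 * T)) x); [exact Hx|ring].
Qed.

(** The derivative is extended as a continuous function and then integrated;
    the primitive satisfies the difference equation because the derivative of
    the defect vanishes and the defect itself vanishes at [0]. *)
Lemma C1_extension (T : R) (a a' k k' : R -> R) :
  0 < T -> C1_on_with (- T) T a a' ->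
  (forall x, is_derive k x (k' x)) -> (forall x, continuous k' x) ->
  a T - a (- T) = k 0 -> a' T - a' (- T) = k' 0 ->
  exists v, C1_line v /\ (forall x, - T <= x <= T -> v x = a x) /\
    forall x, v (x + T) - v (x - T) = k x.
Proof.
  intros hT [Ha Ha'] Hk Hk' Ek Ek'.
  destruct (continuous_extension T a' k' hT Ha' Hk' Ek') as (w & Hwc & Hwa & Hw).
  pose (v := fun x => a (- T) + RInt w (- T) x).
  assert (Hv : forall x, is_derive v x (w x)).
  { intros x; apply is_derive_value with (0 + w x); [|ring].
    apply (is_derive_Rplus (fun _ => a (- T))); [apply @is_derive_const|].
    now apply is_derive_primitive. }
  assert (Hva : forall x, - T <= x <= T -> v x = a x).
  { assert (Hac : continuous_on (fun y => - T <= y <= T) a).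
    { intros x Hx.
      exact (is_derive_within_continuous _ _ _ _ Hx (Ha x Hx)). }
    assert (Hvc : forall x, continuous v x)
      by (intros x; exact (is_derive_continuous _ _ _ (Hv x))).
    intros x Hx; apply Rminus_diag_uniq.
    rewrite <- (clamp_id (- T) T x Hx) at 2.
    rewrite (constant_of_derive_zero (- T) T (fun x => v x - a (clamp (- T) T x)));
      [| | |exact Hx].
    - rewrite clamp_id by lra; unfold v; rewrite RInt_point.
      unfold zero; simpl; ring.
    - intros s; apply continuous_Rminus; [apply Hvc|].
      apply continuous_clamp; [lra|exact Hac].
    - intros s Hs; apply is_derive_value with (w s - a' s).
      + apply is_derive_Rminus; [apply Hv|].
        apply is_derive_ext_loc with a.
        * generalize (locally_interior _ _ _ Hs); apply filter_imp.
          intros y Hy; now rewrite clamp_id.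
        * apply (is_derive_of_within (fun y => - T <= y <= T));
            [now apply locally_interior|apply Ha; lra].
      + rewrite Hwa by lra; ring. }
  exists v; split; [exists w; split; auto|split; [exact Hva|]].
  intros x.
  assert (E : v (x + T) - v (x + - T) - k x = v (0 + T) - v (0 + - T) - k 0).
  { apply (constant_of_derive_zero_line (fun x => v (x + T) - v (x + - T) - k x)).
    intros y; apply is_derive_value with (w (y + T) - w (y + - T) - k' y).
    - apply is_derive_Rminus; [apply is_derive_Rminus|apply Hk];
        now apply is_derive_shift.
    - rewrite <- (Hw y); unfold Rminus; ring. }
  rewrite !Rplus_0_l, (Hva T), (Hva (- T)) in E by lra.
  replace (x - T) with (x + - T) by ring; lra.
Qed.

(** * Sums of distances to a list of points *)

Definition Rsum (l : list R) : R := fold_right Rplus 0 l.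

Lemma Rsum_app (l m : list R) : Rsum (l ++ m) = Rsum l + Rsum m.
Proof.
  unfold Rsum; induction l as [|x l IH]; simpl; [ring|rewrite IH; ring].
Qed.

Lemma Rsum_perm (l m : list R) : Permutation l m -> Rsum l = Rsum m.
Proof.
  unfold Rsum; induction 1; simpl; lra.
Qed.

Definition cost (l : list R) (y : R) : R := Rsum (map (fun t => Rabs (y - t)) l).

Definition count_gt (y : R) (l : list R) : nat :=
  length (filter (fun t => if Rlt_dec y t then true else false) l).

Definition count_ge (y : R) (l : list R) : nat :=
  length (filter (fun t => if Rle_dec y t then true else false) l).

Lemma Permutation_length_filter (p : R -> bool) (l m : list R) :
  Permutation l m -> length (filter p l) = length (filter p m).
Proof.
  induction 1 as [|x l m _ IH|x y l|]; simpl; try congruence.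
  - destruct (p x); simpl; congruence.
  - destruct (p x), (p y); simpl; congruence.
Qed.

Lemma filter_length_all (p : R -> bool) (l : list R) :
  (forall t, In t l -> p t = true) -> length (filter p l) = length l.
Proof.
  induction l as [|x l IH]; simpl; intros H; [reflexivity|].
  rewrite (H x) by auto; simpl; rewrite ?IH; auto.
Qed.

Lemma filter_length_none (p : R -> bool) (l : list R) :
  (forall t, In t l -> p t = false) -> length (filter p l) = 0%nat.
Proof.
  induction l as [|x l IH]; simpl; intros H; [reflexivity|].
  rewrite (H x) by auto; simpl; rewrite ?IH; auto.
Qed.

(** The [j]-th largest entry, counted from [1]. *)
Definition ranked (j : nat) (l : list R) : R :=
  nth (j - 1) (RDecreasing.sort l) 0.

Lemma ranked_split (l : list R) (j : nat) :
  (1 <= j <= length l)%nat ->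
  exists s1 s2, Permutation l (s1 ++ ranked j l :: s2) /\
    length s1 = (j - 1)%nat /\
    (forall t, In t s1 -> ranked j l <= t) /\
    (forall t, In t s2 -> t <= ranked j l).
Proof.
  intros Hj; unfold ranked; set (s := RDecreasing.sort l).
  assert (Hp : Permutation l s) by apply RDecreasing.Permuted_sort.
  assert (Hs : StronglySorted (fun x y => is_true (RGeOrder.leb x y)) s).
  { apply RDecreasing.StronglySorted_sort.
    intros x y z; unfold is_true, RGeOrder.leb.
    destruct (Rle_dec y x), (Rle_dec z y), (Rle_dec z x);
      try discriminate; auto; lra. }
  assert (Hlt : (j - 1 < length s)%nat).
  { rewrite <- (Permutation_length Hp); lia. }
  destruct (nth_split s 0 Hlt) as (s1 & s2 & Es & Hl).
  exists s1, s2; split; [rewrite <- Es; exact Hp|split; [exact Hl|]].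
  set (a := nth (j - 1) s 0) in *.
  clearbody a s; subst s; clear - Hs.
  induction s1 as [|x s1 IH]; simpl in Hs.
  - split; [now intros t []|].
    apply StronglySorted_inv in Hs; destruct Hs as [_ Hf].
    rewrite Forall_forall in Hf; intros t Ht; specialize (Hf t Ht).
    unfold is_true, RGeOrder.leb in Hf.
    destruct (Rle_dec t a); [lra|discriminate].
  - apply StronglySorted_inv in Hs; destruct Hs as [Hs Hf].
    destruct (IH Hs) as [H1 H2]; split; [|exact H2].
    intros t [<-|Ht]; [|now apply H1].
    rewrite Forall_forall in Hf.
    specialize (Hf a (in_elt a s1 s2)).
    unfold is_true, RGeOrder.leb in Hf.
    destruct (Rle_dec a x); [lra|discriminate].
Qed.

Lemma ranked_eq (l : list R) (j : nat) (y : R) :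
  (count_gt y l < j <= count_ge y l)%nat -> ranked j l = y.
Proof.
  intros Hj.
  assert (Hjl : (1 <= j <= length l)%nat).
  { unfold count_ge in Hj.
    pose proof (filter_length_le (fun t => if Rle_dec y t then true else false) l).
    lia. }
  destruct (ranked_split l j Hjl) as (s1 & s2 & Hp & Hl & H1 & H2).
  set (a := ranked j l) in *.
  unfold count_gt, count_ge in Hj.
  rewrite !(Permutation_length_filter _ _ _ Hp), !filter_app, !length_app in Hj.
  destruct (Rtotal_order a y) as [Hlt|[He|Hgt]]; [exfalso|exact He|exfalso].
  - destruct Hj as [_ Hj].
    rewrite (filter_length_none _ (a :: s2)) in Hj.
    + pose proof (filter_length_le (fun t => if Rle_dec y t then true else false) s1).
      lia.
    + intros t [<-|Ht]; destruct (Rle_dec y _); auto; [lra|].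
      specialize (H2 t Ht); lra.
  - destruct Hj as [Hj _].
    rewrite (filter_length_all _ s1) in Hj.
    + simpl in Hj; destruct (Rlt_dec y a); [simpl in Hj; lia|lra].
    + intros t Ht; specialize (H1 t Ht); destruct (Rlt_dec y t); auto; lra.
Qed.

Lemma cost_below (s : list R) (a y : R) :
  (forall t, In t s -> t <= a) ->
  cost s a + INR (length s) * (y - a) <= cost s y.
Proof.
  unfold cost, Rsum; induction s as [|x s IH]; intros H.
  - simpl; lra.
  - cbn [map fold_right length]; rewrite S_INR.
    specialize (IH (fun t Ht => H t (or_intror Ht))).
    pose proof (H x (or_introl eq_refl)).
    rewrite (Rabs_pos_eq (a - x)) by lra.
    pose proof (Rle_abs (y - x)); lra.
Qed.

Lemma cost_above (s : list R) (a y : R) :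
  (forall t, In t s -> a <= t) ->
  cost s a - INR (length s) * (y - a) <= cost s y.
Proof.
  unfold cost, Rsum; induction s as [|x s IH]; intros H.
  - simpl; lra.
  - cbn [map fold_right length]; rewrite S_INR.
    specialize (IH (fun t Ht => H t (or_intror Ht))).
    pose proof (H x (or_introl eq_refl)).
    rewrite (Rabs_minus_sym a x), (Rabs_pos_eq (x - a)) by lra.
    pose proof (Rle_abs (x - y)); rewrite (Rabs_minus_sym y x); lra.
Qed.

(** With [K] entries in [l], the subdifferential of the convex function
    [cost l] at its [j]-th largest breakpoint contains
    [K - 2 * j, K - 2 * j + 2]. The slope used here is the midpoint, and the
    margin [1] on both sides gives the last term. It depends on [K] and [j]
    only, not on the points of [l]. *)
Lemma cost_ranked (l : list R) (j : nat) (y : R) :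
  (1 <= j <= length l)%nat ->
  cost l (ranked j l) + (INR (length l) + 1 - 2 * INR j) * (y - ranked j l)
    + Rabs (y - ranked j l) <= cost l y.
Proof.
  intros Hj; destruct (ranked_split l j Hj) as (s1 & s2 & Hp & Hl & H1 & H2).
  set (a := ranked j l) in *.
  assert (Hcost : forall z, cost l z = cost s1 z + (Rabs (z - a) + cost s2 z)).
  { intros z; unfold cost.
    rewrite (Rsum_perm _ _ (Permutation_map _ Hp)), map_app, Rsum_app.
    reflexivity. }
  rewrite (Permutation_length Hp), length_app; simpl length.
  rewrite Nat.add_succ_r, S_INR, plus_INR, !Hcost.
  assert (Ej : INR j = INR (length s1) + 1).
  { rewrite <- S_INR; f_equal; lia. }
  rewrite Ej, Rminus_diag, Rabs_R0.
  pose proof (cost_below s2 a y H2); pose proof (cost_above s1 a y H1).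
  lra.
Qed.

(** * The norm of an input as an integral over one period *)

(** The translations that carry [-T, T] onto the [K] periods making up the
    interval of the norm, in the order of the [t_i]. *)
Definition shifts (T : R) (K1 K2 : nat) : list R :=
  0 :: map (fun k => 2 * INR k * T) (seq 1 K2)
    ++ map (fun k => - (2 * INR k * T)) (seq 1 K1).

Lemma length_shifts (T : R) (K1 K2 : nat) :
  length (shifts T K1 K2) = (K1 + K2 + 1)%nat.
Proof.
  unfold shifts; simpl; rewrite length_app, !length_map, !length_seq; lia.
Qed.

Lemma sum_n_first (F : nat -> R) (n : nat) :
  sum_n F (S n) = F 0%nat + sum_n (fun i => F (S i)) n.
Proof.
  unfold sum_n; rewrite sum_Sn_m by lia.
  rewrite <- sum_n_m_S; reflexivity.
Qed.

Lemma t_right_eq (f0 fT : R -> R) (T : R) (v : R -> R) (k : nat) (x : R) :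
  (forall x, v (x + T) - v (x - T) = jump f0 fT T x) -> (1 <= k)%nat ->
  t_right f0 fT T k x = v x - v (x + 2 * INR k * T).
Proof.
  intros Hv Hk.
  assert (Hv' : forall y, v (y + 2 * T) - v y =
    2 * Derive fT (y + T) - Derive f0 (y + 2 * T) - Derive f0 y).
  { intros y; specialize (Hv (y + T)); unfold jump in Hv.
    replace (y + T + T) with (y + 2 * T) in Hv by ring.
    replace (y + T - T) with y in Hv by ring; exact Hv. }
  clear Hv; induction Hk as [|k Hk IH].
  - unfold t_right; simpl; rewrite !sum_O; simpl.
    replace (x + (2 * 1 - 2 * 0) * T) with (x + 2 * T) by ring.
    replace (x + (2 * 1 - 2 * 0 - 1) * T) with (x + T) by ring.
    replace (x + 2 * 1 * T) with (x + 2 * T) by ring.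
    specialize (Hv' x); lra.
  - unfold t_right in *.
    replace (S k - 1)%nat with (S (k - 1)) by lia.
    rewrite !sum_n_first.
    rewrite (sum_n_ext (fun i => Derive f0 (x + (2 * INR (S k) - 2 * INR (S i)) * T))
              (fun n => Derive f0 (x + (2 * INR k - 2 * INR n) * T))).
    2: { intros n; do 3 f_equal; rewrite !S_INR; ring. }
    rewrite (sum_n_ext (fun i => Derive fT (x + (2 * INR (S k) - 2 * INR (S i) - 1) * T))
              (fun n => Derive fT (x + (2 * INR k - 2 * INR n - 1) * T))).
    2: { intros n; do 3 f_equal; rewrite !S_INR; ring. }
    specialize (Hv' (x + 2 * INR k * T)).
    rewrite S_INR; simpl INR.
    replace (x + (2 * (INR k + 1) - 2 * 0) * T) with
      (x + 2 * INR k * T + 2 * T) by ring.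
    replace (x + 2 * (INR k + 1) * T) with (x + 2 * INR k * T + 2 * T) by ring.
    replace (x + (2 * (INR k + 1) - 2 * 0 - 1) * T) with
      (x + 2 * INR k * T + T) by ring.
    lra.
Qed.

Lemma t_left_eq (f0 fT : R -> R) (T : R) (v : R -> R) (k : nat) (x : R) :
  (forall x, v (x + T) - v (x - T) = jump f0 fT T x) -> (1 <= k)%nat ->
  t_left f0 fT T k x = v x - v (x + - (2 * INR k * T)).
Proof.
  intros Hv Hk.
  assert (Hv' : forall y, v y - v (y - 2 * T) =
    2 * Derive fT (y - T) - Derive f0 y - Derive f0 (y - 2 * T)).
  { intros y; specialize (Hv (y - T)); unfold jump in Hv.
    replace (y - T - T) with (y - 2 * T) in Hv by ring.
    replace (y - T + T) with y in Hv by ring; exact Hv. }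
  clear Hv; induction Hk as [|k Hk IH].
  - unfold t_left; simpl; rewrite !sum_O; simpl.
    replace (x + (2 * 0 + 1 - 2 * 1) * T) with (x - T) by ring.
    replace (x + 2 * (0 + 1 - 1) * T) with x by ring.
    replace (x - 2 * 1 * T) with (x - 2 * T) by ring.
    replace (x + - (2 * 1 * T)) with (x - 2 * T) by ring.
    specialize (Hv' x); lra.
  - unfold t_left in *.
    replace (S k - 1)%nat with (S (k - 1)) by lia.
    rewrite !sum_n_first.
    rewrite (sum_n_ext (fun i => Derive fT (x + (2 * INR (S i) + 1 - 2 * INR (S k)) * T))
              (fun n => Derive fT (x + (2 * INR n + 1 - 2 * INR k) * T))).
    2: { intros n; do 3 f_equal; rewrite !S_INR; ring. }
    rewrite (sum_n_ext (fun i => Derive f0 (x + 2 * (INR (S i) + 1 - INR (S k)) * T))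
              (fun n => Derive f0 (x + 2 * (INR n + 1 - INR k) * T))).
    2: { intros n; do 3 f_equal; rewrite !S_INR; ring. }
    specialize (Hv' (x - 2 * INR k * T)).
    rewrite S_INR; simpl INR.
    replace (x + (2 * 0 + 1 - 2 * (INR k + 1)) * T) with
      (x - 2 * INR k * T - T) by ring.
    replace (x + 2 * (0 + 1 - (INR k + 1)) * T) with (x - 2 * INR k * T) by ring.
    replace (x - 2 * (INR k + 1) * T) with (x - 2 * INR k * T - 2 * T) by ring.
    replace (x + - (2 * (INR k + 1) * T)) with (x - 2 * INR k * T - 2 * T) by ring.
    replace (x + - (2 * INR k * T)) with (x - 2 * INR k * T) in IH by ring.
    lra.
Qed.

(** Iterating the difference equation gives [v (x + s_i) = v x - t_i(x)], where
    [t_i(x)] is the same for all inputs [v]. *)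
Lemma t_values_eq (f0 fT : R -> R) (T : R) (K1 K2 : nat) (v : R -> R) (x : R) :
  (forall x, v (x + T) - v (x - T) = jump f0 fT T x) ->
  t_values f0 fT T K1 K2 x = map (fun s => v x - v (x + s)) (shifts T K1 K2).
Proof.
  intros Hv; unfold t_values, shifts; simpl; rewrite map_app, !map_map.
  f_equal; [rewrite Rplus_0_r; ring|f_equal].
  - apply map_ext_in; intros k Hk; apply in_seq in Hk.
    apply t_right_eq; [exact Hv|lia].
  - apply map_ext_in; intros k Hk; apply in_seq in Hk.
    apply t_left_eq; [exact Hv|lia].
Qed.

Definition cost_shifts (l : list R) (w : R -> R) (x : R) : R :=
  Rsum (map (fun s => Rabs (w (x + s))) l).

Lemma cost_t_values (f0 fT : R -> R) (T : R) (K1 K2 : nat) (w : R -> R) (x : R) :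
  (forall x, w (x + T) - w (x - T) = jump f0 fT T x) ->
  cost (t_values f0 fT T K1 K2 x) (w x) = cost_shifts (shifts T K1 K2) w x.
Proof.
  intros Hw; unfold cost, cost_shifts.
  rewrite (t_values_eq f0 fT T K1 K2 w x Hw), map_map.
  f_equal; apply map_ext; intros s; f_equal; ring.
Qed.

Lemma continuous_cost_shifts (l : list R) (w : R -> R) (x : R) :
  (forall x, continuous w x) -> continuous (cost_shifts l w) x.
Proof.
  intros Hw; unfold cost_shifts, Rsum; induction l as [|s l IH]; simpl.
  - apply continuous_const.
  - apply (continuous_Rplus (fun x => Rabs (w (x + s)))); [|exact IH].
    apply continuous_Rabs_comp; now apply continuous_shift.
Qed.

Lemma L1_norm_shifts (T : R) (K1 K2 : nat) (w : R -> R) :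
  (forall x, continuous w x) ->
  L1_norm T K1 K2 w = RInt (cost_shifts (shifts T K1 K2) w) (- T) T.
Proof.
  intros Hw.
  pose (g := fun x => Rabs (w x)).
  assert (Hg : forall x, continuous g x)
    by (intros x; now apply continuous_Rabs_comp).
  assert (Hfold : forall l, RInt (cost_shifts l w) (- T) T =
                    Rsum (map (fun s => RInt g (- T + s) (T + s)) l)).
  { induction l as [|s l IH].
    - unfold cost_shifts, Rsum; simpl.
      rewrite (RInt_const (- T) T 0); exact (Rmult_0_r _).
    - change (RInt (fun x => g (x + s) + cost_shifts l w x) (- T) T =
        RInt g (- T + s) (T + s) +
        Rsum (map (fun s => RInt g (- T + s) (T + s)) l)).
      rewrite <- IH, <- (RInt_shift g s) by exact Hg.
      apply (RInt_Rplus (fun x => g (x + s))).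
      + intros x; now apply continuous_shift.
      + intros x; now apply continuous_cost_shifts. }
  rewrite Hfold; clear Hfold; unfold shifts.
  cbn [map]; rewrite map_app, !map_map.
  change (L1_norm T K1 K2 w = RInt g (- T + 0) (T + 0) +
    Rsum (map (fun k => RInt g (- T + 2 * INR k * T) (T + 2 * INR k * T))
            (seq 1 K2) ++
          map (fun k => RInt g (- T + - (2 * INR k * T)) (T + - (2 * INR k * T)))
            (seq 1 K1))).
  rewrite Rsum_app, !Rplus_0_r.
  assert (Hr : Rsum (map (fun k => RInt g (- T + 2 * INR k * T) (T + 2 * INR k * T))
            (seq 1 K2)) = RInt g T ((2 * INR K2 + 1) * T)).
  { induction K2 as [|K IH].
    - simpl; rewrite Rmult_0_r, Rplus_0_l, Rmult_1_l, RInt_point; reflexivity.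
    - rewrite seq_S, map_app, Rsum_app, IH; cbn [map Nat.add].
      rewrite (RInt_split g T ((2 * INR K + 1) * T) ((2 * INR (S K) + 1) * T))
        by exact Hg.
      unfold Rsum; cbn [fold_right]; rewrite Rplus_0_r.
      rewrite S_INR; do 2 f_equal; ring. }
  assert (Hl : Rsum (map (fun k =>
             RInt g (- T + - (2 * INR k * T)) (T + - (2 * INR k * T)))
            (seq 1 K1)) = RInt g (- (2 * INR K1 + 1) * T) (- T)).
  { clear Hr; induction K1 as [|K IH].
    - simpl; replace (- (2 * 0 + 1) * T) with (- T) by ring.
      rewrite RInt_point; reflexivity.
    - rewrite seq_S, map_app, Rsum_app, IH; cbn [map Nat.add].
      rewrite (RInt_split g (- (2 * INR (S K) + 1) * T)
                (- (2 * INR K + 1) * T) (- T)) by exact Hg.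
      unfold Rsum; cbn [fold_right]; rewrite Rplus_0_r, Rplus_comm.
      rewrite S_INR; do 2 f_equal; ring. }
  rewrite Hr, Hl; unfold L1_norm; fold g.
  rewrite (RInt_split g _ (- T) _), (RInt_split g (- T) T _) by exact Hg.
  ring.
Qed.

(** * Perturbations that do not increase the norm *)

Lemma is_derive_Rmax0_sqr (y : R) :
  is_derive (fun y => Rmax 0 y * Rmax 0 y) y (2 * Rmax 0 y).
Proof.
  destruct (Rtotal_order y 0) as [Hy|[->|Hy]].
  - apply is_derive_ext_loc with (fun _ => 0).
    + generalize (locally_interior (2 * y) 0 y ltac:(lra)); apply filter_imp.
      intros z Hz; rewrite Rmax_left by lra; symmetry; apply Rmult_0_l.
    + rewrite Rmax_left by lra; rewrite Rmult_0_r; apply @is_derive_const.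
  - rewrite Rmax_left, Rmult_0_r by lra.
    apply (is_derive_of_within (fun _ => True)); [apply filter_true|].
    apply is_derive_within_iff; [exact I|]; intros eps.
    generalize (locally_ball 0 eps); apply filter_imp; intros z Hz _.
    change (Rabs (z - 0) < eps) in Hz.
    rewrite (Rmax_left 0 0), Rmult_0_r, Rmult_0_r, !Rminus_0_r by lra.
    rewrite Rminus_0_r in Hz.
    assert (Hm : 0 <= Rmax 0 z <= Rabs z).
    { split; [apply Rmax_l|apply Rmax_lub; [apply Rabs_pos|apply Rle_abs]]. }
    rewrite Rabs_pos_eq by (apply Rmult_le_pos; lra).
    apply Rmult_le_compat; lra.
  - apply is_derive_ext_loc with (fun z => z * z).
    + generalize (locally_interior 0 (2 * y) y ltac:(lra)); apply filter_imp.
      intros z Hz; now rewrite Rmax_right by lra.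
    + rewrite Rmax_right by lra; auto_derive; [exact I|ring].
Qed.

(** The positive part of [rho^2 - z^2] is squared to be of class C1 where it
    reaches [0]. *)
Lemma bump_function (rho : R) :
  0 < rho <= 1 ->
  exists beta beta' : R -> R, (forall z : R, is_derive beta z (beta' z)) /\
    (forall z : R, continuous beta' z) /\ (forall z : R, 0 <= beta z <= 1) /\
    (forall z : R, rho <= Rabs z -> beta z = 0 /\ beta' z = 0) /\ 0 < beta 0.
Proof.
  intros Hr.
  pose (m := fun z => Rmax 0 (rho * rho - z * z)).
  exists (fun z => m z * m z), (fun z => (-2 * z) * (2 * m z)).
  assert (Hd : forall z : R, is_derive (fun z => rho * rho - z * z) z (-2 * z)).
  { intros z; auto_derive; [exact I|ring]. }
  assert (Hm : forall z, 0 <= m z <= 1).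
  { intros z; unfold m; split; [apply Rmax_l|].
    assert (0 <= z * z) by apply Rle_0_sqr.
    assert (rho * rho <= 1 * 1) by (apply Rmult_le_compat; lra).
    apply Rmax_lub; lra. }
  split; [|split; [|split; [|split]]].
  - intros z.
    apply (is_derive_comp (fun y => Rmax 0 y * Rmax 0 y)
             (fun z => rho * rho - z * z)); [|apply Hd].
    apply is_derive_Rmax0_sqr.
  - intros z.
    apply (continuous_scal (fun z => -2 * z) (fun z => 2 * m z)).
    + apply continuous_Rscal, continuous_id.
    + apply continuous_Rscal, continuous_Rmax0.
      exact (is_derive_continuous _ _ _ (Hd z)).
  - intros z; specialize (Hm z); split; [apply Rmult_le_pos; lra|].
    rewrite <- (Rmult_1_l 1); apply Rmult_le_compat; lra.
  - intros z Hz.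
    assert (E : m z = 0).
    { unfold m; apply Rmax_left.
      assert (rho * rho <= Rabs z * Rabs z) by (apply Rmult_le_compat; lra).
      assert (Rabs z * Rabs z = z * z).
      { rewrite <- Rabs_mult; apply Rabs_pos_eq, Rle_0_sqr. }
      lra. }
    rewrite E; split; ring.
  - assert (0 < m 0); [|now apply Rmult_lt_0_compat].
    unfold m; rewrite Rmult_0_r, Rminus_0_r.
    apply Rlt_le_trans with (rho * rho); [|apply Rmax_r].
    apply Rmult_lt_0_compat; lra.
Qed.

Definition count_neg (w : R -> R) (l : list R) (x : R) : nat :=
  length (filter (fun s => if Rlt_dec (w (x + s)) 0 then true else false) l).

(** Terms with [w (x0 + s) < 0] decrease when [w] is raised slightly, uniformly
    near [x0] by continuity; the others increase at most at rate [1]. The bound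
    is thus linear in [e] with one slope on a whole neighbourhood, although the
    breakpoints move with [x]. *)
Lemma cost_raise (l : list R) (w : R -> R) (x0 : R) :
  (forall x, continuous w x) ->
  exists d, 0 < d /\ forall x e, Rabs (x - x0) < d -> 0 <= e <= d ->
    Rsum (map (fun s => Rabs (w (x + s) + e)) l) <=
    cost_shifts l w x + (INR (length l) - 2 * INR (count_neg w l x0)) * e.
Proof.
  intros Hw; unfold cost_shifts, count_neg, Rsum.
  induction l as [|s l (d & Hd & IH)].
  - exists 1; split; [lra|]; intros x e _ He; simpl; lra.
  - cbn [map fold_right filter length].
    destruct (Rlt_dec (w (x0 + s)) 0) as [Hneg|Hneg].
    + assert (Hc : continuous (fun x => w (x + s)) x0)
        by now apply continuous_shift.
      assert (Hp : 0 < - w (x0 + s) / 2) by lra.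
      destruct (proj1 (filterlim_locally _ _) Hc (mkposreal _ Hp)) as [d' Hd'].
      exists (Rmin d (Rmin d' (- w (x0 + s) / 2))).
      pose proof (Rmin_l d (Rmin d' (- w (x0 + s) / 2))).
      pose proof (Rmin_r d (Rmin d' (- w (x0 + s) / 2))).
      pose proof (Rmin_l d' (- w (x0 + s) / 2)).
      pose proof (Rmin_r d' (- w (x0 + s) / 2)).
      pose proof (cond_pos d').
      split; [repeat apply Rmin_case; lra|]; intros x e Hx He.
      specialize (IH x e ltac:(lra) ltac:(lra)).
      assert (Hb : Rabs (w (x + s) - w (x0 + s)) < - w (x0 + s) / 2).
      { apply (Hd' x); change (Rabs (x - x0) < d'); lra. }
      apply Rabs_def2 in Hb.
      cbn [length]; rewrite !S_INR.
      rewrite (Rabs_left1 (w (x + s) + e)), (Rabs_left1 (w (x + s))) by lra.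
      lra.
    + exists d; split; [exact Hd|]; intros x e Hx He.
      specialize (IH x e Hx He).
      cbn [length]; rewrite S_INR.
      pose proof (Rabs_triang (w (x + s)) e) as Ht.
      rewrite (Rabs_pos_eq e) in Ht by lra; lra.
Qed.

Lemma cost_lower (l : list R) (w : R -> R) (x0 : R) :
  (forall x, continuous w x) ->
  exists d, 0 < d /\ forall x e, Rabs (x - x0) < d -> 0 <= e <= d ->
    Rsum (map (fun s => Rabs (w (x + s) + - e)) l) <=
    cost_shifts l w x
      + (INR (length l) - 2 * INR (count_neg (fun x => - w x) l x0)) * e.
Proof.
  intros Hw.
  destruct (cost_raise l (fun x => - w x) x0) as (d & Hd & H).
  { intros x; apply (continuous_opp w), Hw. }
  exists d; split; [exact Hd|]; intros x e Hx He; specialize (H x e Hx He).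
  unfold cost_shifts in *.
  rewrite (map_ext _ (fun s => Rabs (w (x + s) + - e))) in H.
  - rewrite (map_ext (fun s => Rabs (- w (x + s))) (fun s => Rabs (w (x + s)))) in H.
    + exact H.
    + intros s; apply Rabs_Ropp.
  - intros s; rewrite <- Rabs_Ropp; f_equal; ring.
Qed.

(** The bumps must be disjoint and contained in one period even when
    [x1 = x2] or when these points are end points of [-T, T]. *)
Lemma disjoint_supports (T d x1 x2 : R) :
  0 < T -> 0 < d -> - T <= x1 <= T -> - T <= x2 <= T ->
  exists y1 y2 rho, 0 < rho <= 1 /\ 2 * rho <= Rabs (y1 - y2) /\
    (- T + rho <= y1 <= T - rho) /\ (- T + rho <= y2 <= T - rho) /\
    (forall z, Rabs (z - y1) < rho -> Rabs (z - x1) < d) /\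
    (forall z, Rabs (z - y2) < rho -> Rabs (z - x2) < d).
Proof.
  intros hT hd H1 H2.
  set (r := Rmin d (Rmin T 1) / 8).
  assert (Hr : 0 < r /\ 8 * r <= d /\ 8 * r <= T /\ 8 * r <= 1).
  { unfold r; pose proof (Rmin_l d (Rmin T 1)); pose proof (Rmin_r d (Rmin T 1)).
    pose proof (Rmin_l T 1); pose proof (Rmin_r T 1).
    assert (0 < Rmin d (Rmin T 1)) by (repeat apply Rmin_case; lra).
    repeat split; lra. }
  (* the two candidates for y2 are 4 * r apart, so one is far from y1 *)
  assert (Hin : forall x, - T <= x <= T -> exists p q, q - p = 4 * r /\
     (- T + r <= p <= T - r) /\ (- T + r <= q <= T - r) /\
     Rabs (p - x) <= 6 * r /\ Rabs (q - x) <= 6 * r).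
  { intros x Hx; destruct (Rle_dec x 0).
    - exists (x + 2 * r), (x + 6 * r); repeat split; try lra;
        apply Rabs_le; lra.
    - exists (x - 6 * r), (x - 2 * r); repeat split; try lra;
        apply Rabs_le; lra. }
  assert (Hnear : forall x y, Rabs (y - x) <= 6 * r ->
            forall z, Rabs (z - y) < r -> Rabs (z - x) < d).
  { intros x y Hy z Hz; replace (z - x) with ((z - y) + (y - x)) by ring.
    eapply Rle_lt_trans; [apply Rabs_triang|lra]. }
  destruct (Hin x1 H1) as (y1 & _ & _ & Hy1 & _ & Ny1 & _).
  destruct (Hin x2 H2) as (p & q & Epq & Hp & Hq & Np & Nq).
  destruct (Rle_dec (2 * r) (Rabs (y1 - p))) as [Hle|Hgt].
  - exists y1, p, r; repeat split; try lra; now apply Hnear.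
  - exists y1, q, r; repeat split; try lra; try now apply Hnear.
    apply Rnot_le_lt in Hgt; apply Rabs_def2 in Hgt.
    rewrite Rabs_left1; lra.
Qed.

Lemma RInt_bump (beta : R -> R) (T y rho : R) :
  0 < rho -> - T + rho <= y <= T - rho ->
  (forall z, continuous beta z) -> (forall z, rho <= Rabs z -> beta z = 0) ->
  RInt (fun x => beta (x - y)) (- T) T = RInt beta (- rho) rho.
Proof.
  intros Hr Hy Hc H0.
  assert (Hz : forall a b, a <= b -> b <= - rho \/ rho <= a -> RInt beta a b = 0).
  { intros a b Hab Hor; rewrite (RInt_ext beta (fun _ => 0)).
    - rewrite RInt_const; exact (Rmult_0_r _).
    - rewrite Rmin_left, Rmax_right by lra; intros z Hz; apply H0.
      destruct Hor; [rewrite Rabs_left1|rewrite Rabs_pos_eq]; lra. }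
  rewrite (RInt_shift beta (- y)) by exact Hc.
  rewrite (RInt_split beta _ (- rho) _), (RInt_split beta (- rho) rho _) by exact Hc.
  rewrite (Hz (- T + - y) (- rho)), (Hz rho (T + - y)) by lra.
  rewrite Rplus_0_l, Rplus_0_r; reflexivity.
Qed.

(** The perturbation is [d * (b2 - b1)] for congruent bumps [b1] and [b2] with
    disjoint supports near [x1] and [x2]. By the slope bounds for lowering and
    raising it changes the integral by at most [2 * (length l - N1 - N2)] times
    [d] times the integral of one bump, where [N1] and [N2] are the two
    counts. *)
Lemma free_perturbation (T : R) (l : list R) (w : R -> R) (x1 x2 : R) :
  0 < T -> (forall x, continuous w x) ->
  - T <= x1 <= T -> - T <= x2 <= T ->
  (length l <= count_neg (fun x => - w x) l x1 + count_neg w l x2)%nat ->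
  exists phi phi' : R -> R,
    (forall x : R, is_derive phi x (phi' x)) /\ (forall x : R, continuous phi' x) /\
    RInt phi (- T) T = 0 /\
    phi T = 0 /\ phi (- T) = 0 /\ phi' T = 0 /\ phi' (- T) = 0 /\
    (exists y, - T <= y <= T /\ phi y <> 0) /\
    RInt (fun x => Rsum (map (fun s => Rabs (w (x + s) + phi x)) l)) (- T) T <=
    RInt (cost_shifts l w) (- T) T.
Proof.
  intros hT Hw Hx1 Hx2 Hcount.
  destruct (cost_lower l w x1 Hw) as (d1 & Hd1 & Hlow).
  destruct (cost_raise l w x2 Hw) as (d2 & Hd2 & Hup).
  set (d := Rmin d1 d2).
  assert (Hd : 0 < d /\ d <= d1 /\ d <= d2).
  { unfold d; pose proof (Rmin_l d1 d2); pose proof (Rmin_r d1 d2).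
    split; [apply Rmin_case|]; lra. }
  destruct (disjoint_supports T d x1 x2 hT (proj1 Hd) Hx1 Hx2)
    as (y1 & y2 & rho & Hrho & Hsep & Hy1 & Hy2 & Hn1 & Hn2).
  destruct (bump_function rho Hrho) as (beta & beta' & Hb & Hb' & Hb01 & Hb0 & Hbp).
  assert (Hbc : forall z, continuous beta z)
    by (intros z; exact (is_derive_continuous _ _ _ (Hb z))).
  set (b1 := fun x => beta (x + - y1)); set (b2 := fun x => beta (x + - y2)).
  assert (Hb1c : forall x, continuous b1 x)
    by (intros x; now apply continuous_shift).
  assert (Hb2c : forall x, continuous b2 x)
    by (intros x; now apply continuous_shift).
  assert (Hfar : forall x y, rho <= Rabs (x - y) ->
            beta (x + - y) = 0 /\ beta' (x + - y) = 0)
    by (intros x y H; now apply Hb0).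
  set (phi := fun x => d * (b2 x - b1 x)).
  set (phi' := fun x => d * (beta' (x + - y2) - beta' (x + - y1))).
  assert (Hphi : forall x, is_derive phi x (phi' x)).
  { intros x; apply is_derive_scal, is_derive_Rminus; now apply is_derive_shift. }
  assert (Hphic : forall x, continuous phi x)
    by (intros x; exact (is_derive_continuous _ _ _ (Hphi x))).
  assert (HI1 : RInt b1 (- T) T = RInt beta (- rho) rho).
  { apply RInt_bump; try lra; auto; intros z Hz; now apply Hb0. }
  assert (HI2 : RInt b2 (- T) T = RInt beta (- rho) rho).
  { apply RInt_bump; try lra; auto; intros z Hz; now apply Hb0. }
  assert (Hend : forall x, x = T \/ x = - T -> phi x = 0 /\ phi' x = 0).
  { intros x Hx; unfold phi, phi', b1, b2.
    assert (F : forall y, - T + rho <= y <= T - rho -> rho <= Rabs (x - y)).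
    { intros y Hy; destruct Hx as [->| ->];
        [rewrite Rabs_pos_eq|rewrite Rabs_left1]; lra. }
    destruct (Hfar x y1 (F y1 Hy1)) as [-> ->].
    destruct (Hfar x y2 (F y2 Hy2)) as [-> ->]; split; ring. }
  exists phi, phi'; repeat apply conj.
  - exact Hphi.
  - intros x; apply continuous_Rscal, continuous_Rminus; now apply continuous_shift.
  - unfold phi; rewrite (RInt_Rscal (fun x => b2 x - b1 x)).
    2: { intros x; now apply continuous_Rminus. }
    rewrite (RInt_minus b2 b1) by now apply ex_RInt_cont.
    rewrite HI1, HI2; unfold minus, plus, opp; simpl; ring.
  - apply (Hend T); now left.
  - apply (Hend (- T)); now right.
  - apply (Hend T); now left.
  - apply (Hend (- T)); now right.
  - exists y2; split; [lra|]; unfold phi, b1, b2.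
    rewrite Rplus_opp_r.
    destruct (Hfar y2 y1) as [-> _].
    { rewrite Rabs_minus_sym; lra. }
    assert (0 < d * beta 0) by (apply Rmult_lt_0_compat; lra); lra.
  - set (N1 := count_neg (fun x => - w x) l x1) in *.
    set (N2 := count_neg w l x2) in *.
    set (k1 := (INR (length l) - 2 * INR N1) * d).
    set (k2 := (INR (length l) - 2 * INR N2) * d).
    assert (Hcc : forall x, continuous (cost_shifts l w) x)
      by (intros x; now apply continuous_cost_shifts).
    apply Rle_trans with
      (RInt (fun x => cost_shifts l w x + (k1 * b1 x + k2 * b2 x)) (- T) T).
    + apply RInt_le; [lra| | |].
      * apply ex_RInt_cont; intros x; unfold Rsum; clear - Hw Hphic.
        induction l as [|s l IH]; simpl; [apply continuous_const|].
        apply (continuous_Rplus (fun x => Rabs (w (x + s) + phi x)));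
          [|exact IH].
        apply continuous_Rabs_comp, continuous_Rplus; [|apply Hphic].
        now apply continuous_shift.
      * apply ex_RInt_cont; intros x.
        apply continuous_Rplus; [apply Hcc|].
        apply continuous_Rplus; now apply continuous_Rscal.
      * intros x _.
        destruct (Rlt_dec (Rabs (x - y1)) rho) as [H1|H1];
        [|destruct (Rlt_dec (Rabs (x - y2)) rho) as [H2|H2]].
        -- assert (E2 : b2 x = 0).
           { apply Hfar; replace (x - y2) with ((y1 - y2) - (y1 - x)) by ring.
             pose proof (Rabs_triang_inv (y1 - y2) (y1 - x)) as Ht.
             rewrite (Rabs_minus_sym y1 x) in Ht; lra. }
           assert (He : 0 <= d * b1 x <= d1).
           { pose proof (Hb01 (x + - y1)); fold (b1 x) in *.
             split; [apply Rmult_le_pos; lra|].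
             apply Rle_trans with (d * 1); [apply Rmult_le_compat_l|]; lra. }
           specialize (Hn1 x H1).
           specialize (Hlow x (d * b1 x) ltac:(lra) He).
           unfold phi; rewrite E2.
           replace (d * (0 - b1 x)) with (- (d * b1 x)) by ring.
           eapply Rle_trans; [exact Hlow|unfold k1, N1; lra].
        -- assert (E1 : b1 x = 0) by (apply Hfar; lra).
           assert (He : 0 <= d * b2 x <= d2).
           { pose proof (Hb01 (x + - y2)); fold (b2 x) in *.
             split; [apply Rmult_le_pos; lra|].
             apply Rle_trans with (d * 1); [apply Rmult_le_compat_l|]; lra. }
           specialize (Hn2 x H2).
           specialize (Hup x (d * b2 x) ltac:(lra) He).
           unfold phi; rewrite E1, Rminus_0_r.
           eapply Rle_trans; [exact Hup|unfold k2, N2; lra].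
        -- assert (E1 : b1 x = 0) by (apply Hfar; lra).
           assert (E2 : b2 x = 0) by (apply Hfar; lra).
           unfold phi, cost_shifts; rewrite E1, E2.
           rewrite (map_ext _ (fun s => Rabs (w (x + s)))).
           ++ lra.
           ++ intros s; f_equal; ring.
    + rewrite (RInt_Rplus (cost_shifts l w) (fun x => k1 * b1 x + k2 * b2 x)).
      2: exact Hcc.
      2: { intros x; apply continuous_Rplus; now apply continuous_Rscal. }
      rewrite (RInt_Rplus (fun x => k1 * b1 x) (fun x => k2 * b2 x))
        by (intros x; now apply continuous_Rscal).
      rewrite !RInt_Rscal, HI1, HI2 by assumption.
      assert (HB : 0 <= RInt beta (- rho) rho).
      { apply RInt_ge_0; [lra|now apply ex_RInt_cont|].
        intros z _; apply Hb01. }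
      apply le_INR in Hcount; rewrite plus_INR in Hcount.
      assert (k1 + k2 <= 0).
      { unfold k1, k2; rewrite <- Rmult_plus_distr_r.
        rewrite <- (Rmult_0_l d); apply Rmult_le_compat_r; lra. }
      assert ((k1 + k2) * RInt beta (- rho) rho <= 0 * RInt beta (- rho) rho)
        by (apply Rmult_le_compat_r; lra).
      lra.
Qed.

(** * Ranked values are unique minimizers *)

Lemma admissible_continuous (f0 fT : R -> R) (T : R) (v : R -> R) (x : R) :
  admissible f0 fT T v -> continuous v x.
Proof. intros [H _]; now apply C1_line_continuous. Qed.

(** The linear term of the subgradient inequality has a slope independent of
    [x] and all inputs have the same integral over [-T, T], so this term
    integrates to zero. *)
Lemma ranked_minimal (f0 fT : R -> R) (T : R) (K1 K2 j : nat) (v w : R -> R) :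
  0 < T -> smooth f0 -> smooth fT -> (1 <= j <= K1 + K2 + 1)%nat ->
  admissible f0 fT T v -> admissible f0 fT T w ->
  (forall x, - T <= x <= T -> v x = a_fun f0 fT T K1 K2 j x) ->
  L1_norm T K1 K2 v + RInt (fun x => Rabs (w x - v x)) (- T) T
    <= L1_norm T K1 K2 w.
Proof.
  intros hT H0 HT Hj Hv Hw Hva.
  assert (Hvc : forall x, continuous v x)
    by (intros x; exact (admissible_continuous _ _ _ _ x Hv)).
  assert (Hwc : forall x, continuous w x)
    by (intros x; exact (admissible_continuous _ _ _ _ x Hw)).
  apply (admissible_iff f0 fT T v H0 HT) in Hv; destruct Hv as (_ & HvA & Hvj).
  apply (admissible_iff f0 fT T w H0 HT) in Hw; destruct Hw as (_ & HwA & Hwj).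
  rewrite !L1_norm_shifts by assumption.
  set (l := shifts T K1 K2).
  set (lam := INR (length l) + 1 - 2 * INR j).
  pose (dif := fun x => w x - v x).
  assert (Hdc : forall x, continuous dif x)
    by (intros x; now apply continuous_Rminus).
  assert (Hac : forall x, continuous (fun x => Rabs (dif x)) x)
    by (intros x; now apply continuous_Rabs_comp).
  assert (Hlc : forall x, continuous (cost_shifts l v) x)
    by (intros x; now apply continuous_cost_shifts).
  assert (Hsc : forall x, continuous (fun x => lam * dif x) x)
    by (intros x; now apply continuous_Rscal).
  assert (Hd0 : RInt dif (- T) T = 0).
  { unfold dif; rewrite (RInt_minus w v) by now apply ex_RInt_cont.
    rewrite HvA, HwA; apply Rminus_diag. }
  apply Rle_trans with
    (RInt (fun x => cost_shifts l v x + (lam * dif x + Rabs (dif x))) (- T) T).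
  - rewrite (RInt_Rplus (cost_shifts l v) (fun x => lam * dif x + Rabs (dif x)));
      [|exact Hlc|intros x; now apply continuous_Rplus].
    rewrite (RInt_Rplus (fun x => lam * dif x) (fun x => Rabs (dif x)))
      by assumption.
    rewrite RInt_Rscal, Hd0 by exact Hdc.
    unfold dif; lra.
  - apply RInt_le; [lra| | |].
    + apply ex_RInt_cont; intros x.
      apply continuous_Rplus; [apply Hlc|now apply continuous_Rplus].
    + apply ex_RInt_cont; intros x; now apply continuous_cost_shifts.
    + intros x Hx; unfold l.
      rewrite <- (cost_t_values f0 fT T K1 K2 v x Hvj).
      rewrite <- (cost_t_values f0 fT T K1 K2 w x Hwj).
      assert (Hlen : length (t_values f0 fT T K1 K2 x) = (K1 + K2 + 1)%nat).
      { rewrite (t_values_eq f0 fT T K1 K2 v x Hvj), length_map.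
        apply length_shifts. }
      pose proof (cost_ranked (t_values f0 fT T K1 K2 x) j (w x)) as Hc.
      rewrite Hlen in Hc; specialize (Hc Hj).
      change (ranked j (t_values f0 fT T K1 K2 x)) with
        (a_fun f0 fT T K1 K2 j x) in Hc.
      rewrite <- Hva in Hc by lra.
      unfold lam, l, dif; rewrite length_shifts; lra.
Qed.

Lemma admissible_determined_on_period (f0 fT : R -> R) (T : R) (v w : R -> R) :
  0 < T -> smooth f0 -> smooth fT ->
  admissible f0 fT T v -> admissible f0 fT T w ->
  (forall x, - T <= x <= T -> v x = w x) -> forall x, v x = w x.
Proof.
  intros hT H0 HT Hv Hw He.
  apply (admissible_iff f0 fT T v H0 HT) in Hv; destruct Hv as (_ & _ & Hvj).
  apply (admissible_iff f0 fT T w H0 HT) in Hw; destruct Hw as (_ & _ & Hwj).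
  apply (period_induction T); [exact hT| | |].
  - intros x Hx; apply He; lra.
  - intros x Hx; specialize (Hvj (x + T)); specialize (Hwj (x + T)).
    replace (x + T - T) with x in Hvj, Hwj by ring.
    replace (x + T + T) with (x + 2 * T) in Hvj, Hwj by ring; lra.
  - intros x Hx; specialize (Hvj (x - T)); specialize (Hwj (x - T)).
    replace (x - T + T) with x in Hvj, Hwj by ring.
    replace (x - T - T) with (x - 2 * T) in Hvj, Hwj by ring; lra.
Qed.

Lemma has_input_ext (T : R) (u : R * R -> R) (v w : R -> R) :
  (forall x, v x = w x) -> has_input T u v -> has_input T u w.
Proof. intros He Hv x; rewrite <- He; apply Hv. Qed.

Lemma is_MS_iff (f0 fT : R -> R) (T : R) (K1 K2 : nat) (u : R * R -> R) :
  0 < T -> smooth f0 ->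
  (is_MS f0 fT T K1 K2 u <->
   is_solution f0 fT T u /\
   exists v, has_input T u v /\ admissible f0 fT T v /\
     forall w, admissible f0 fT T w -> L1_norm T K1 K2 v <= L1_norm T K1 K2 w).
Proof.
  intros hT H0; split.
  - intros (Hu & v & Hv & Hm); split; [exact Hu|]; exists v.
    split; [exact Hv|split; [now apply (input_admissible f0 fT T u)|]].
    intros w Hw; apply Hm; now apply input_space_iff.
  - intros (Hu & v & Hv & _ & Hm); split; [exact Hu|]; exists v.
    split; [exact Hv|]; intros w Hw; apply Hm; now apply input_space_iff.
Qed.

Lemma dAlembert_MS (f0 fT : R -> R) (T : R) (K1 K2 : nat) (v : R -> R) :
  0 < T -> smooth f0 -> admissible f0 fT T v ->
  (forall w, admissible f0 fT T w -> L1_norm T K1 K2 v <= L1_norm T K1 K2 w) ->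
  is_MS f0 fT T K1 K2 (dAlembert f0 v).
Proof.
  intros hT H0 Hv Hm; destruct (dAlembert_solution f0 fT T v hT H0 Hv) as [Hs Hi].
  apply is_MS_iff; auto; split; [exact Hs|]; now exists v.
Qed.

Lemma jump_0 (f0 fT : R -> R) (T : R) : jump f0 fT T 0 = const_c1 f0 fT T.
Proof. unfold jump, const_c1; now rewrite Rplus_0_l, Rminus_0_l. Qed.

Lemma derivative_jump_0 (f0 fT : R -> R) (T : R) (v v' : R -> R) :
  smooth f0 -> smooth fT -> (forall x, is_derive v x (v' x)) ->
  (forall x, v (x + T) - v (x - T) = jump f0 fT T x) ->
  v' T - v' (- T) = const_c2 f0 fT T.
Proof.
  intros H0 HT Hv Hvj.
  destruct (C1_line_jump f0 fT T H0 HT) as (k' & Hk & _ & <-).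
  assert (Hd : is_derive (jump f0 fT T) 0 (v' (0 + T) - v' (0 + - T))).
  { apply is_derive_ext with (fun x => v (x + T) - v (x + - T)).
    - intros x; apply Hvj.
    - apply is_derive_Rminus; now apply is_derive_shift. }
  rewrite !Rplus_0_l in Hd.
  apply is_derive_unique in Hd; rewrite <- Hd.
  exact (is_derive_unique _ _ _ (Hk 0)).
Qed.

Lemma a_condition_unique (f0 fT : R -> R) (T : R) (K1 K2 : nat) :
  0 < T -> smooth f0 -> smooth fT ->
  a_condition f0 fT T K1 K2 -> exactly_one_MS f0 fT T K1 K2.
Proof.
  intros hT H0 HT (j & Hj & HA & a' & HC1 & Hc1 & Hc2).
  set (a := a_fun f0 fT T K1 K2 j) in *.
  destruct (C1_line_jump f0 fT T H0 HT) as (k' & Hk & Hk' & Ek').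
  destruct (C1_extension T a a' (jump f0 fT T) k' hT HC1 Hk Hk')
    as (v & Hv1 & Hva & Hvj).
  { rewrite jump_0; lra. }
  { rewrite Ek'; lra. }
  assert (Hv : admissible f0 fT T v).
  { apply admissible_iff; auto; split; [exact Hv1|split; [|exact Hvj]].
    rewrite <- HA; apply RInt_ext.
    rewrite Rmin_left, Rmax_right by lra; intros x Hx; apply Hva; lra. }
  assert (Hopt : forall w, admissible f0 fT T w ->
    L1_norm T K1 K2 v + RInt (fun x => Rabs (w x - v x)) (- T) T
      <= L1_norm T K1 K2 w).
  { intros w Hw; now apply (ranked_minimal f0 fT T K1 K2 j v w). }
  assert (Hdc : forall w, admissible f0 fT T w ->
            forall x, continuous (fun x => Rabs (w x - v x)) x).
  { intros w Hw x; apply continuous_Rabs_comp, continuous_Rminus;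
      now apply (admissible_continuous f0 fT T). }
  assert (Hmin : forall w, admissible f0 fT T w ->
            L1_norm T K1 K2 v <= L1_norm T K1 K2 w).
  { intros w Hw; specialize (Hopt w Hw).
    assert (0 <= RInt (fun x => Rabs (w x - v x)) (- T) T); [|lra].
    apply RInt_ge_0; [lra|apply ex_RInt_cont, Hdc, Hw|].
    intros x _; apply Rabs_pos. }
  exists (dAlembert f0 v); split; [now apply dAlembert_MS|].
  intros u Hu; apply is_MS_iff in Hu; auto.
  destruct Hu as (Hu & w & Huw & Hw & Hwm).
  assert (Hvw : forall x, w x = v x).
  { apply (admissible_determined_on_period f0 fT T); auto.
    intros x Hx; apply Rminus_diag_uniq.
    destruct (Req_dec (w x - v x) 0) as [|Hne]; [assumption|].
    apply Rabs_no_R0 in Hne; destruct Hne.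
    apply (RInt_nonneg_zero (fun x => Rabs (w x - v x)) (- T) T); auto.
    - lra.
    - intros y; apply Rabs_pos.
    - specialize (Hopt w Hw); specialize (Hwm v Hv); lra. }
  destruct (dAlembert_solution f0 fT T v hT H0 Hv) as [Hs Hi].
  apply (solution_determined_by_input f0 fT T _ _ v); auto.
  now apply (has_input_ext T u w).
Qed.

(** * A unique minimizer is a ranked value *)

Lemma nat_max_attained (I : R -> Prop) (f : R -> nat) (N : nat) :
  (exists x, I x) -> (forall x, I x -> (f x <= N)%nat) ->
  exists x0, I x0 /\ forall x, I x -> (f x <= f x0)%nat.
Proof.
  intros [x1 H1]; induction N as [|N IH]; intros HN.
  - exists x1; split; [exact H1|]; intros x Hx; specialize (HN x Hx); lia.
  - destruct (classic (exists x, I x /\ f x = S N)) as [(x & Hx & Ex)|Hno].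
    + exists x; split; [exact Hx|]; rewrite Ex; exact HN.
    + apply IH; intros x Hx.
      assert (f x <> S N) by (intros E; apply Hno; now exists x).
      specialize (HN x Hx); lia.
Qed.

Lemma count_gt_translates (v : R -> R) (l : list R) (x : R) :
  count_gt (v x) (map (fun s => v x - v (x + s)) l) = count_neg v l x.
Proof.
  unfold count_gt, count_neg; induction l as [|s l IH]; simpl; [reflexivity|].
  destruct (Rlt_dec (v x) (v x - v (x + s))), (Rlt_dec (v (x + s)) 0);
    simpl; auto; lra.
Qed.

Lemma count_ge_translates (v : R -> R) (l : list R) (x : R) :
  (count_ge (v x) (map (fun s => (v x - v (x + s))%R) l)
   + count_neg (fun x => (- v x)%R) l x = length l)%nat.
Proof.
  unfold count_ge, count_neg; induction l as [|s l IH]; simpl; [reflexivity|].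
  destruct (Rle_dec (v x) (v x - v (x + s))), (Rlt_dec (- v (x + s)) 0);
    simpl; lra || lia.
Qed.

(** Otherwise there is a perturbation of zero mean that keeps the norm
    minimal; it is flat at the ends of the period, so it extends to another
    input. *)
Lemma unique_counts (f0 fT : R -> R) (T : R) (K1 K2 : nat) (v : R -> R) :
  0 < T -> smooth f0 -> smooth fT -> admissible f0 fT T v ->
  (forall w, admissible f0 fT T w -> L1_norm T K1 K2 w <= L1_norm T K1 K2 v ->
     forall x, w x = v x) ->
  forall x1 x2, - T <= x1 <= T -> - T <= x2 <= T ->
    (count_neg (fun x => (- v x)%R) (shifts T K1 K2) x1
     + count_neg v (shifts T K1 K2) x2 < K1 + K2 + 1)%nat.
Proof.
  intros hT H0 HT Hv Huniq x1 x2 Hx1 Hx2.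
  apply Nat.nle_gt; intros Hle; rewrite <- (length_shifts T K1 K2) in Hle.
  assert (Hvc : forall x, continuous v x)
    by (intros x; exact (admissible_continuous _ _ _ _ x Hv)).
  destruct (free_perturbation T (shifts T K1 K2) v x1 x2 hT Hvc Hx1 Hx2 Hle)
    as (phi & phi' & Hphi & Hphi' & HI & P1 & P2 & P3 & P4 & (y & Hy & Hne) & Hcost).
  pose proof Hv as Hv0.
  apply (admissible_iff f0 fT T v H0 HT) in Hv0.
  destruct Hv0 as ((v' & Hdv & Hcv) & HvA & Hvj).
  assert (Hphic : forall x, continuous phi x)
    by (intros x; exact (is_derive_continuous _ _ _ (Hphi x))).
  destruct (C1_line_jump f0 fT T H0 HT) as (k' & Hk & Hk' & Ek').
  destruct (C1_extension T (fun x => v x + phi x) (fun x => v' x + phi' x)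
              (jump f0 fT T) k' hT) as (w & Hw1 & Hwa & Hwj); auto.
  { split.
    - intros x Hx; apply is_derive_within_of_is_derive; [exact Hx|].
      now apply is_derive_Rplus.
    - apply continuous_on_of_continuous; intros x; now apply continuous_Rplus. }
  { rewrite P1, P2, <- Hvj, Rplus_0_l, Rminus_0_l; ring. }
  { rewrite P3, P4, Ek', <- (derivative_jump_0 f0 fT T v v') by auto; ring. }
  assert (Hwc : forall x, continuous w x)
    by (intros x; now apply C1_line_continuous).
  assert (Hw : admissible f0 fT T w).
  { apply admissible_iff; auto; split; [exact Hw1|split; [|exact Hwj]].
    rewrite (RInt_ext w (fun x => v x + phi x)).
    - rewrite RInt_Rplus, HI, HvA by assumption; apply Rplus_0_r.
    - rewrite Rmin_left, Rmax_right by lra; intros x Hx; apply Hwa; lra. }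
  apply Hne.
  assert (E : w y = v y).
  { apply Huniq; [exact Hw|].
    rewrite !L1_norm_shifts by assumption.
    eapply Rle_trans; [|exact Hcost].
    apply Req_le, RInt_ext; rewrite Rmin_left, Rmax_right by lra.
    intros x Hx; unfold cost_shifts; f_equal.
    (* w - v is periodic: both solve the same difference equation *)
    pose proof (t_values_eq f0 fT T K1 K2 w x Hwj) as Tw.
    rewrite (t_values_eq f0 fT T K1 K2 v x Hvj) in Tw.
    apply map_ext_in; intros s Hs; f_equal.
    apply ext_in_map with (1 := Tw) in Hs.
    rewrite Hwa in Hs by lra; lra. }
  rewrite Hwa in E by lra; lra.
Qed.

(** The strict inequality between counts at two independent points gives one
    [j] for the whole period: if [M] is the largest number of positive
    translates, then [j = K - M] exceeds the number of [t_i(x)] greater than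
    [v x] and is at most the number of those not smaller, for every [x]. Hence
    [v x] is the [j]-th largest of the [t_i(x)]. *)
Lemma unique_a_condition (f0 fT : R -> R) (T : R) (K1 K2 : nat) :
  0 < T -> smooth f0 -> smooth fT ->
  exactly_one_MS f0 fT T K1 K2 -> a_condition f0 fT T K1 K2.
Proof.
  intros hT H0 HT (u & Hu & Huniq).
  apply is_MS_iff in Hu; auto; destruct Hu as (Hu & v & Huv & Hv & Hmin).
  assert (Hvuniq : forall w, admissible f0 fT T w ->
    L1_norm T K1 K2 w <= L1_norm T K1 K2 v -> forall x, w x = v x).
  { intros w Hw Hle x; symmetry.
    destruct (dAlembert_solution f0 fT T w hT H0 Hw) as [_ Hi].
    apply (input_determined_by_solution T u (dAlembert f0 w)); auto.
    apply Huniq, dAlembert_MS; auto.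
    intros z Hz; specialize (Hmin z Hz); lra. }
  pose proof (unique_counts f0 fT T K1 K2 v hT H0 HT Hv Hvuniq) as Hcnt.
  set (l := shifts T K1 K2) in *.
  destruct (nat_max_attained (fun x => - T <= x <= T)
              (count_neg (fun x => - v x) l) (K1 + K2 + 1)) as (x0 & Hx0 & Hmax).
  { exists 0; lra. }
  { intros x Hx; specialize (Hcnt x x Hx Hx); lia. }
  set (M := count_neg (fun x => - v x) l x0) in *.
  exists (K1 + K2 + 1 - M)%nat.
  apply (admissible_iff f0 fT T v H0 HT) in Hv.
  destruct Hv as ((v' & Hdv & Hcv) & HvA & Hvj).
  assert (Hva : forall x, - T <= x <= T ->
            v x = a_fun f0 fT T K1 K2 (K1 + K2 + 1 - M) x).
  { intros x Hx; symmetry.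
    apply (ranked_eq (t_values f0 fT T K1 K2 x)).
    rewrite (t_values_eq f0 fT T K1 K2 v x Hvj); fold l.
    rewrite count_gt_translates.
    pose proof (count_ge_translates v l x) as Hge.
    unfold l in Hge at 3; rewrite length_shifts in Hge.
    specialize (Hmax x Hx); specialize (Hcnt x0 x Hx0 Hx); fold M in Hcnt; lia. }
  split; [specialize (Hcnt x0 x0 Hx0 Hx0); fold M in Hcnt; lia|].
  cbv zeta; set (a := a_fun f0 fT T K1 K2 (K1 + K2 + 1 - M)) in *.
  split.
  { rewrite <- HvA; apply RInt_ext; rewrite Rmin_left, Rmax_right by lra.
    intros x Hx; symmetry; apply Hva; lra. }
  exists v'; split; [split|split].
  - intros x Hx; apply (is_derive_within_ext _ v); [exact Hx|exact Hva|].
    now apply is_derive_within_of_is_derive.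
  - now apply continuous_on_of_continuous.
  - rewrite <- !Hva, <- jump_0, <- Hvj, Rplus_0_l, Rminus_0_l by lra; ring.
  - pose proof (derivative_jump_0 f0 fT T v v' H0 HT Hdv Hvj) as E.
    rewrite <- E; symmetry; apply Rplus_minus.
Qed.

(** * Non-uniqueness gives a segment of minimizers *)

Lemma admissible_segment (f0 fT : R -> R) (T k : R) (v w : R -> R) :
  smooth f0 -> smooth fT -> admissible f0 fT T v -> admissible f0 fT T w ->
  admissible f0 fT T (fun x => (1 - k) * v x + k * w x).
Proof.
  intros H0 HT Hv Hw.
  assert (Hvc : forall x, continuous v x)
    by (intros x; exact (admissible_continuous _ _ _ _ x Hv)).
  assert (Hwc : forall x, continuous w x)
    by (intros x; exact (admissible_continuous _ _ _ _ x Hw)).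
  destruct Hv as [Hv1 HvI], Hw as [Hw1 HwI]; split.
  - apply C1_line_ext with (fun x => (v x + - k * v x) + k * w x).
    { intros x; ring. }
    now apply (C1_line_lin (fun x => v x + - k * v x) w); [apply C1_line_lin|].
  - intros x.
    rewrite (RInt_Rplus (fun x => (1 - k) * v x) (fun x => k * w x))
      by (intros y; now apply continuous_Rscal).
    rewrite !RInt_Rscal, HvI, HwI by assumption.
    apply Rminus_diag_uniq; ring.
Qed.

Lemma L1_norm_segment (T k : R) (K1 K2 : nat) (v w : R -> R) :
  0 < T -> 0 <= k <= 1 ->
  (forall x, continuous v x) -> (forall x, continuous w x) ->
  L1_norm T K1 K2 (fun x => (1 - k) * v x + k * w x) <=
  (1 - k) * L1_norm T K1 K2 v + k * L1_norm T K1 K2 w.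
Proof.
  intros hT Hk Hv Hw; unfold L1_norm.
  set (lo := - (2 * INR K1 + 1) * T); set (hi := (2 * INR K2 + 1) * T).
  assert (Hlh : lo <= hi).
  { unfold lo, hi; apply Rmult_le_compat_r; [lra|].
    pose proof (pos_INR K1); pose proof (pos_INR K2); lra. }
  assert (Hva : forall x, continuous (fun x => Rabs (v x)) x)
    by (intros x; now apply continuous_Rabs_comp).
  assert (Hwa : forall x, continuous (fun x => Rabs (w x)) x)
    by (intros x; now apply continuous_Rabs_comp).
  rewrite <- !RInt_Rscal by assumption.
  rewrite <- (RInt_Rplus (fun x => (1 - k) * Rabs (v x)) (fun x => k * Rabs (w x)))
    by (intros x; now apply continuous_Rscal).
  apply RInt_le; [exact Hlh| | |].
  - apply ex_RInt_cont; intros x.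
    apply continuous_Rabs_comp, continuous_Rplus; now apply continuous_Rscal.
  - apply ex_RInt_cont; intros x.
    apply continuous_Rplus; now apply continuous_Rscal.
  - intros x _; eapply Rle_trans; [apply Rabs_triang|].
    rewrite !Rabs_mult, (Rabs_pos_eq (1 - k)), (Rabs_pos_eq k) by lra; lra.
Qed.

(** The inputs form an affine space and the norm is convex, so the minimizers
    contain the segment between any two of them. *)
Lemma two_MS_infinitely_many (f0 fT : R -> R) (T : R) (K1 K2 : nat)
  (u u' : R * R -> R) :
  0 < T -> smooth f0 -> smooth fT ->
  is_MS f0 fT T K1 K2 u -> is_MS f0 fT T K1 K2 u' -> ~ eq_on_strip T u u' ->
  infinitely_many_MS f0 fT T K1 K2.
Proof.
  intros hT H0 HT Hu Hu' Hne.
  apply is_MS_iff in Hu; auto; apply is_MS_iff in Hu'; auto.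
  destruct Hu as (Hu & v & Huv & Hv & Hm), Hu' as (Hu' & w & Huw & Hw & Hm').
  set (k := fun n => / (INR n + 1)).
  set (z := fun n x => (1 - k n) * v x + k n * w x).
  assert (Hkp : forall n, 0 < INR n + 1) by (intros n; pose proof (pos_INR n); lra).
  assert (Hk : forall n, 0 <= k n <= 1).
  { intros n; split; [left; apply Rinv_0_lt_compat, Hkp|].
    unfold k; rewrite <- Rinv_1; apply Rinv_le_contravar; [lra|].
    pose proof (pos_INR n); lra. }
  assert (Hz : forall n, admissible f0 fT T (z n))
    by (intros n; now apply admissible_segment).
  exists (fun n => dAlembert f0 (z n)); split.
  - intros n; apply dAlembert_MS; auto.
    intros y Hy; eapply Rle_trans; [apply L1_norm_segment; auto|].
    { intros x; exact (admissible_continuous _ _ _ _ x Hv). }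
    { intros x; exact (admissible_continuous _ _ _ _ x Hw). }
    specialize (Hm y Hy); specialize (Hm' y Hy); specialize (Hk n).
    assert ((1 - k n) * L1_norm T K1 K2 v <= (1 - k n) * L1_norm T K1 K2 y)
      by (apply Rmult_le_compat_l; lra).
    assert (k n * L1_norm T K1 K2 w <= k n * L1_norm T K1 K2 y)
      by (apply Rmult_le_compat_l; lra).
    lra.
  - intros m n Hmn He; apply Hne.
    assert (Hkmn : k m - k n <> 0).
    { intros E; apply Hmn, INR_eq.
      apply Rminus_diag_uniq, Rinv_eq_reg in E; lra. }
    assert (Hvw : forall x, w x = v x).
    { intros x.
      assert (E : z m x = z n x).
      { apply (input_determined_by_solution T (dAlembert f0 (z m))
                 (dAlembert f0 (z n)) (z m) (z n)); auto;
          now apply (dAlembert_solution f0 fT T). }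
      unfold z in E; apply Rminus_diag_uniq.
      apply Rmult_eq_reg_l with (k m - k n); [|exact Hkmn].
      rewrite Rmult_0_r; lra. }
    apply (solution_determined_by_input f0 fT T u u' v); auto.
    now apply (has_input_ext T u' w).
Qed.

Theorem mainTheorem5 (f0 fT : R -> R) (T : R) (K1 K2 : nat)
  (hT : 0 < T) (hf0 : smooth f0) (hfT : smooth fT)
  (hK1 : (1 <= K1)%nat) (hK2 : (1 <= K2)%nat) :
  (exactly_one_MS f0 fT T K1 K2 <-> a_condition f0 fT T K1 K2) /\
  (~ a_condition f0 fT T K1 K2 ->
   (exists u, is_MS f0 fT T K1 K2 u) ->
   infinitely_many_MS f0 fT T K1 K2).
Proof.
  assert (Hiff : exactly_one_MS f0 fT T K1 K2 <-> a_condition f0 fT T K1 K2).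
  { split; [now apply unique_a_condition|now apply a_condition_unique]. }
  split; [exact Hiff|]; intros Hna [u Hu].
  apply NNPP; intros Hninf; apply Hna, Hiff.
  exists u; split; [exact Hu|]; intros u' Hu'.
  apply NNPP; intros Hne; apply Hninf.
  now apply (two_MS_infinitely_many f0 fT T K1 K2 u u').
Qed.
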